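(* Let $p = 2j/(2j-1)$ for some integer $j>1$, and let $f$ be a function in $L^p$. Then $f$ has a majorant in $L^p$ whose $L^p$ norm is no larger than $\|f\|_p$. Moreover, the minimal majorant $F$ of $f$ in $L^p$ factors as $F = (\overline{G})^{j-1}G^j$, where $G \in L^{2j}$ and $\hat G(n) \ge 0$ for all integers $n$. Furthermore $\hat G(n) = 0$ for every integer $n$ with $\hat F(n) > |\hat f(n)|$, and $\hat G(n)=0$ for every integer $n$ with $\hat f(n) = 0$.
   Context: $L^p$ denotes the space of complex-valued ($2\pi$-periodic) functions on $[-\pi,\pi)$ with norm $\|f\|_p = \left(\frac{1}{2\pi}\int_{-\pi}^{\pi}|f(\theta)|^p\,d\theta\right)^{1/p}$, and $\hat f(n) = \frac{1}{2\pi}\int_{-\pi}^\pi f(\theta)e^{-in\theta}\,d\theta$ for integers $n$. A function $F$ is a majorant of $f$ when $|\hat f(n)| \le \hat F(n)$ for all integers $n$ (in particular $\hat F(n)$ is real and nonnegative). For $1<p<\infty$ the majorants of $f$ in $L^p$ form a closed convex subset of $L^p$; when it is nonempty, its unique element of least $L^p$ norm is called the minimal majorant of $f$ in $L^p$. *)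

(* Defs.v *)
From mathcomp Require Import all_boot all_order all_algebra.
From mathcomp Require Import all_classical all_reals all_analysis.
From mathcomp Require Export complex.

Set Implicit Arguments.
Unset Strict Implicit.
Unset Printing Implicit Defensive.

Import Order.TTheory GRing.Theory Num.Theory.
Import numFieldNormedType.Exports.

Local Open Scope classical_set_scope.
Local Open Scope ring_scope.
Local Open Scope complex_scope.

(* A function on [-pi, pi) is a function R -> R[i] of which only the values on
   [-pi, pi) are ever used; this is the same datum as its 2 pi-periodic
   extension.  Elements of L^p are represented by Borel measurable functions,
   and equality in L^p is equality almost everywhere on [-pi, pi). *)
Definition circle {R : realType} : set R := `[- pi, pi[%classic.

Definition cmeasurable {R : realType} (f : R -> R[i]) : Prop :=
  measurable_fun circle (fun t => complex.Re (f t)) /\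
  measurable_fun circle (fun t => complex.Im (f t)).

Definition circle_norm {R : realType} (p : R) (f : R -> R[i]) : \bar R :=
  (((pi *+ 2)^-1)%:E *
   \int[lebesgue_measure]_(t in circle) (Normc.normc (f t) `^ p)%:E)%E `^ p^-1.

Definition circle_Lp {R : realType} (p : R) (f : R -> R[i]) : Prop :=
  cmeasurable f /\ (circle_norm p f < +oo)%E.

Definition circle_integral {R : realType} (f : R -> R[i]) : R[i] :=
  (\int[lebesgue_measure]_(t in circle) complex.Re (f t)) +i*
  (\int[lebesgue_measure]_(t in circle) complex.Im (f t)).

Definition cis {R : realType} (t : R) : R[i] := cos t +i* sin t.

Definition fourier_coef {R : realType} (f : R -> R[i]) (n : int) : R[i] :=
  ((pi *+ 2)^-1)%:C * circle_integral (fun t => f t * cis (- (n%:~R * t))).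

(* In R[i], x <= y holds iff y - x is a nonnegative real; the inequality below
   therefore also says that the Fourier coefficients of F are real and >= 0. *)
Definition majorant {R : realType} (f F : R -> R[i]) : Prop :=
  forall n : int, `|fourier_coef f n| <= fourier_coef F n.

Definition minimal_majorant {R : realType} (p : R) (f F : R -> R[i]) : Prop :=
  [/\ circle_Lp p F, majorant f F &
      forall H : R -> R[i], circle_Lp p H -> majorant f H ->
        (circle_norm p F <= circle_norm p H)%E].

(* Main.v *)
Require Import Defs.
From mathcomp Require Import all_boot all_order all_algebra.
From mathcomp Require Import all_classical all_reals all_analysis.
From mathcomp Require Import measurable_realfun complex ring lra zify.

Import Order.TTheory GRing.Theory Num.Theory.
Import numFieldNormedType.Exports.

Local Open Scope classical_set_scope.
Local Open Scope ring_scope.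
Local Open Scope complex_scope.

(** Write q = 2 j for the exponent dual to p, and a n for the modulus of the n-th
    Fourier coefficient of f.  The majorant of f of least L^p norm is obtained
    from a dual problem in L^q: minimize

      energy G = ||G||_q^q / q - sum_n a n * Ghat n

    over the trigonometric polynomials G with nonnegative coefficients.

    The energy is bounded below on this cone.  Giving the coefficients of G the
    phases of those of f turns the linear term into the pairing of f with a
    polynomial g, which Young's inequality bounds by ||g||_q^q / q plus a multiple
    of ||f||_p^p; and ||g||_q <= ||G||_q because q is an even integer
    ([trig_majorant], [weight_le_young]).  A minimizing sequence is Cauchy in L^q
    by Clarkson's inequality ([energy_midpoint]).  It is chosen to converge so
    fast that it converges almost everywhere and is dominated by a single function
    of L^q ([fast_limit]); every later passage to the limit is dominated
    convergence.

    Let G be the limit and F = conj(G)^(j-1) G^j, so that F is |G|^(q-2) G, the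
    gradient of ||.||_q^q / q at G.  The derivatives of the energy along the
    minimizing sequence ([energy_variation]) give three facts: adding a multiple
    of the n-th character yields a n <= Fhat n; shrinking the n-th coefficient
    yields Ghat n * (Fhat n - a n) <= 0; shrinking all of G yields that
    ||G||_q^q is at most the limit of the linear terms.  Hence F is a majorant of
    f, and Ghat n vanishes wherever Fhat n > a n.  Moreover
    Fhat n >= (Ghat n)^(q-1) since all coefficients are nonnegative, so
    a n = 0 forces Ghat n = 0 too.

    If H is a majorant of f in L^p, then the pairing of H with a member of the
    minimizing sequence is at least its linear term, so that in the limit
    ||G||_q^q <= Re <H, G> <= ||G||_q^q / q + (1 - 1/q) ||H||_p^p.
    As ||F||_p^p = ||G||_q^q, this says ||F||_p <= ||H||_p, and the equality case
    of Young's inequality says that every minimal majorant H is F almost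
    everywhere.  The bound on the linear term by f gives ||F||_p <= ||f||_p in the
    same way. *)

Local Notation Re := (@complex.Re _).
Local Notation Im := (@complex.Im _).
Local Notation normc := Normc.normc.

Set Implicit Arguments.
Unset Strict Implicit.

(** * Complex arithmetic and pointwise convexity *)

Section Complex.
Context {R : realType}.
Implicit Types z w : R[i].

Lemma re_add z w : Re (z + w) = Re z + Re w. Proof. by case: z w => [? ?] []. Qed.
Lemma im_add z w : Im (z + w) = Im z + Im w. Proof. by case: z w => [? ?] []. Qed.
Lemma re_opp z : Re (- z) = - Re z. Proof. by case: z. Qed.
Lemma im_opp z : Im (- z) = - Im z. Proof. by case: z. Qed.
Lemma re_mul z w : Re (z * w) = Re z * Re w - Im z * Im w.
Proof. by case: z w => [? ?] []. Qed.
Lemma im_mul z w : Im (z * w) = Re z * Im w + Im z * Re w.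
Proof. by case: z w => [? ?] []. Qed.
Lemma re_conj z : Re (conjc z) = Re z. Proof. by case: z. Qed.
Lemma im_conj z : Im (conjc z) = - Im z. Proof. by case: z. Qed.
Lemma complex_eq z w : Re z = Re w -> Im z = Im w -> z = w.
Proof. by case: z w => [a b] [c d] /= -> ->. Qed.

Lemma normc_ge0 z : 0 <= normc z.
Proof. by case: z => a b /=; rewrite sqrtr_ge0. Qed.
Lemma normc_sqrt z : normc z = Num.sqrt (Re z ^+ 2 + Im z ^+ 2).
Proof. by case: z. Qed.
Lemma sqr_normc z : normc z ^+ 2 = Re z ^+ 2 + Im z ^+ 2.
Proof. by rewrite normc_sqrt sqr_sqrtr // addr_ge0 ?sqr_ge0. Qed.
Lemma normc_conj z : normc (conjc z) = normc z.
Proof. by case: z => a b /=; rewrite sqrrN. Qed.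
Lemma normc_exp z n : normc (z ^+ n) = normc z ^+ n.
Proof.
by elim: n => [|n IH]; rewrite ?expr0 ?Normc.normc1 // !exprS Normc.normcM IH.
Qed.
Lemma normc_real (x : R) : normc x%:C = `|x|.
Proof. by rewrite /= expr0n addr0 sqrtr_sqr. Qed.
Lemma normr_normc z : `|z| = (normc z)%:C.
Proof. by []. Qed.
Lemma mul_conj z : z * conjc z = (normc z ^+ 2)%:C.
Proof.
by apply: complex_eq; rewrite ?re_mul ?im_mul re_conj im_conj ?sqr_normc /=; ring.
Qed.
Lemma normc_triangle z w : normc (z + w) <= normc z + normc w.
Proof. exact: le_normcD. Qed.
Lemma normc_opp z : normc (- z) = normc z.
Proof. exact: (@normcN R z). Qed.
Lemma abs_Re_le z : `|Re z| <= normc z.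
Proof.
by rewrite normc_sqrt -sqrtr_sqr ler_sqrt ?addr_ge0 ?sqr_ge0// lerDl sqr_ge0.
Qed.
Lemma abs_Im_le z : `|Im z| <= normc z.
Proof.
by rewrite normc_sqrt -sqrtr_sqr ler_sqrt ?addr_ge0 ?sqr_ge0// lerDr sqr_ge0.
Qed.
Lemma Re_le z : Re z <= normc z.
Proof. exact: le_trans (ler_norm _) (abs_Re_le z). Qed.
Lemma normc_le z : normc z <= `|Re z| + `|Im z|.
Proof.
rewrite -(@ler_pXn2r _ 2) ?nnegrE ?addr_ge0 ?normc_ge0//.
rewrite sqr_normc sqrrD !real_normK ?num_real// addrAC lerDl.
by rewrite mulrn_wge0 // mulr_ge0.
Qed.
Lemma Re_eq_normc z : Re z = normc z -> z = (normc z)%:C.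
Proof.
move=> h; have := sqr_normc z; rewrite -h => /eqP.
rewrite -[X in X == _]addr0 (inj_eq (addrI _)) eq_sym sqrf_eq0 => /eqP h0.
exact: complex_eq.
Qed.

(** Young's inequality for integer exponents, cleared of denominators.  Passing from
    q to q + 1 adds (b - c) (b^q - c^q), which is nonnegative by monotonicity. *)
Lemma bernoulli_pow (b c : R) (q : nat) : 0 <= b -> 0 <= c ->
  q.+1%:R * c ^+ q * b <= q%:R * c ^+ q.+1 + b ^+ q.+1.
Proof.
move=> b0 c0; elim: q => [|q IH]; first by rewrite expr0 mul0r add0r !mul1r expr1.
have /(ler_wpM2l c0) := IH.
have : 0 <= (b - c) * (b ^+ q.+1 - c ^+ q.+1).
  rewrite subrXX mulrA mulr_ge0 //; first by rewrite -expr2 sqr_ge0.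
  by apply: sumr_ge0 => i _; rewrite mulr_ge0 ?exprn_ge0.
by rewrite !exprS -!natr1 => *; lra.
Qed.

(** Equality propagates backwards: the increment (b - c) (b^q - c^q) in the last
    induction step of [bernoulli_pow] is positive unless b = c. *)
Lemma bernoulli_pow_eq (b c : R) (q : nat) : 0 <= b -> 0 <= c -> (0 < q)%N ->
  q.+1%:R * c ^+ q * b = q%:R * c ^+ q.+1 + b ^+ q.+1 -> b = c.
Proof.
case: q => // q b0 c0 _ heq; apply/eqP; rewrite -subr_eq0; apply/negPn/negP => ne.
have /(ler_wpM2l c0) := bernoulli_pow q b0 c0.
have h : 0 < (b - c) * (b ^+ q.+1 - c ^+ q.+1).
  rewrite subrXX mulrA mulr_gt0 //; first by rewrite -expr2 exprn_even_gt0.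
  rewrite lt_neqAle sumr_ge0 ?andbT; last by move=> i _; rewrite mulr_ge0 ?exprn_ge0.
  rewrite eq_sym psumr_neq0; last by move=> i _; rewrite mulr_ge0 ?exprn_ge0.
  have [b1|b1] := boolP (0 < b).
    by apply/hasP; exists ord0; rewrite ?mem_index_enum //= expr0 mulr1 exprn_gt0.
  have bz : b = 0 by apply/eqP; rewrite eq_le b0 andbT leNgt.
  have c1 : 0 < c by rewrite lt_def c0 andbT; move: ne; rewrite bz sub0r oppr_eq0.
  apply/hasP; exists ord_max; rewrite ?mem_index_enum //=.
  by rewrite ?subSS subnn expr0 mul1r exprn_gt0.
move: heq h; rewrite !exprS -!natr1 => *; lra.
Qed.

Lemma superadd_pow (x y : R) n : 0 <= x -> 0 <= y ->
  x ^+ n.+1 + y ^+ n.+1 <= (x + y) ^+ n.+1.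
Proof.
move=> x0 y0; elim: n => [|n IH]; first by rewrite !expr1.
have xy : 0 <= x + y by rewrite addr_ge0.
apply: le_trans (_ : (x + y) * (x ^+ n.+1 + y ^+ n.+1) <= _); last first.
  by rewrite [leRHS]exprS ler_wpM2l.
rewrite mulrDl !mulrDr -!exprS.
have : 0 <= x * y ^+ n.+1 by rewrite mulr_ge0 // exprn_ge0.
have : 0 <= y * x ^+ n.+1 by rewrite mulr_ge0 // exprn_ge0.
lra.
Qed.

(** Add up [bernoulli_pow] at c = (x + y) / 2 for b = x and b = y. *)
Lemma midpoint_pow (x y : R) n : 0 <= x -> 0 <= y ->
  ((x + y) / 2) ^+ n <= (x ^+ n + y ^+ n) / 2.
Proof.
move=> x0 y0; case: n => [|n]; first by rewrite !expr0; lra.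
set m := (x + y) / 2.
have m0 : 0 <= m by rewrite divr_ge0 ?addr_ge0.
have := bernoulli_pow n x0 m0; have := bernoulli_pow n y0 m0.
have mE : x + y = 2 * m by rewrite /m; field.
move: (exprS m n) (natr1 (R:=R) n) => h1 h2.
have : n.+1%:R * m ^+ n * x + n.+1%:R * m ^+ n * y = 2 * (n.+1%:R * m ^+ n.+1).
  by rewrite -mulrDr mE h1; ring.
by rewrite -h2 => *; lra.
Qed.

(** The parallelogram identity is the case j = 1; the exponent j is then moved
    outside by superadditivity on the left and convexity on the right. *)
Lemma clarkson z w j : (0 < j)%N ->
  normc ((1/2)%:C * (z + w)) ^+ (2 * j) + normc ((1/2)%:C * (z - w)) ^+ (2 * j) <=
  (normc z ^+ (2 * j) + normc w ^+ (2 * j)) / 2.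
Proof.
case: j => // j _; rewrite !exprM.
apply: le_trans (superadd_pow _ (sqr_ge0 _) (sqr_ge0 _)) _.
apply: le_trans (midpoint_pow _ (sqr_ge0 _) (sqr_ge0 _)).
rewrite le_eqVlt; apply/orP; left; apply/eqP; congr (_ ^+ _).
by rewrite !Normc.normcM !exprMn !sqr_normc re_add im_add re_add im_add re_opp im_opp /=; field.
Qed.

(** This is |z|^(2 j - 2) z, the gradient of |z|^(2 j) / (2 j), written without moduli so
    that it maps trigonometric polynomials to trigonometric polynomials. *)
Definition dualpow (j : nat) z : R[i] := conjc z ^+ (j - 1) * z ^+ j.

Lemma normc_dualpow j z : (0 < j)%N -> normc (dualpow j z) = normc z ^+ (2 * j - 1).
Proof.
move=> j0; rewrite /dualpow Normc.normcM !normc_exp normc_conj -exprD; congr (_ ^+ _).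
by lia.
Qed.

Lemma dualpow_conj j z : (0 < j)%N -> dualpow j z * conjc z = (normc z ^+ (2 * j))%:C.
Proof.
move=> j0; rewrite /dualpow mulrAC -exprSr subn1 prednK // mulrC -exprMn mul_conj.
by rewrite exprM [RHS]rmorphXn.
Qed.

Section Young.
Variables (j : nat) (p : R).
Hypotheses (hj : (1 < j)%N) (hp : p = (2 * j)%:R / (2 * j - 1)%:R).
Let q := (2 * j)%N.

Lemma conj_exponent : [/\ 0 < p, p^-1 = 1 - q%:R^-1 & (q.-1)%:R * p = q%:R].
Proof.
have q1 : (0 < q.-1)%N by rewrite /q; case: j hj => [|[]].
have even_exponent_gt0 : (0 < q)%N by case: q q1.
have q1R : (0 : R) < q.-1%:R by rewrite ltr0n.
have q0R : (0 : R) < q%:R by rewrite ltr0n.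
rewrite hp subn1 -/q; split.
- by rewrite divr_gt0.
- have -> : q.-1%:R = q%:R - 1 :> R by rewrite -subn1 natrB.
  by field; rewrite gt_eqF // -subn1 natrB // in q1R *; rewrite gt_eqF.
- by field; rewrite gt_eqF.
Qed.

(** With c = |z|^(1/(q-1)) one has |z| = c^(q-1) and |z|^p = c^q, so that the
    inequality becomes [bernoulli_pow].  In the equality case c = |w| and z * conj w
    is a nonnegative real, which determines z. *)
Lemma young_dual z w :
  Re (z * conjc w) <= normc w ^+ q / q%:R + (1 - q%:R^-1) * normc z `^ p
  /\ (Re (z * conjc w) = normc w ^+ q / q%:R + (1 - q%:R^-1) * normc z `^ p ->
     z = dualpow j w).
Proof.
have [p0 _ pq] := conj_exponent.
have q1 : (0 < q.-1)%N by rewrite /q; case: j hj => [|[]].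
have qE : q.-1.+1 = q by rewrite prednK //; case: q q1.
have q1R : (0 : R) < q.-1%:R by rewrite ltr0n.
have q0R : (0 : R) < q%:R by rewrite ltr0n -qE.
pose c := normc z `^ (q.-1%:R^-1).
have c0 : 0 <= c by exact: powR_ge0.
have cz : c ^+ q.-1 = normc z.
  by rewrite -powR_mulrn // /c -powRrM mulVf ?gt_eqF // powRr1 ?normc_ge0.
have cp : normc z `^ p = c ^+ q.
  rewrite -powR_mulrn // /c -powRrM; congr powR.
  by rewrite -pq mulrA mulVf ?gt_eqF // mul1r.
have w0 := normc_ge0 w.
have qq : q%:R = q.-1%:R + 1 :> R by rewrite natr1 qE.
have bern := bernoulli_pow q.-1 w0 c0; have berneq := bernoulli_pow_eq w0 c0 q1.
rewrite !qE cz in bern berneq.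
have le1 : Re (z * conjc w) <= normc z * normc w.
  by rewrite -(normc_conj w) -Normc.normcM Re_le.
have E : normc w ^+ q / q%:R + (1 - q%:R^-1) * normc z `^ p =
    (q.-1%:R * c ^+ q + normc w ^+ q) / q%:R.
  by rewrite cp qq; field; rewrite -qq gt_eqF.
rewrite E; have le2 : normc z * normc w <= (q.-1%:R * c ^+ q + normc w ^+ q) / q%:R.
  by rewrite ler_pdivlMr // mulrC mulrA.
split; first exact: le_trans le2.
move=> heq.
have e1 : Re (z * conjc w) = normc (z * conjc w).
  by apply/le_anti; rewrite Re_le Normc.normcM normc_conj heq le2.
have e2 : normc z * normc w = (q.-1%:R * c ^+ q + normc w ^+ q) / q%:R.
  by apply/le_anti; rewrite le2 -heq le1.
have wc : normc w = c.
  by apply: berneq; rewrite -mulrA e2 mulrC divfK ?gt_eqF.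
have j0 : (0 < j)%N by exact: ltnW.
have [w00|wn0] := eqVneq w 0.
  move: cz; rewrite -wc w00 Normc.normc0 expr0n eqn0Ngt q1 /= => /esym.
  move=> /(@Normc.eq0_normc R) ->.
  by rewrite /dualpow expr0n eqn0Ngt j0 mulr0.
have cw0 : conjc w != 0 by rewrite conjc_eq0.
apply: (mulIf cw0); rewrite dualpow_conj // (Re_eq_normc e1); congr (_%:C).
by rewrite Normc.normcM normc_conj -cz -wc -exprSr qE.
Qed.

Lemma dualpow_powR z : normc (dualpow j z) `^ p = normc z ^+ q.
Proof.
have [_ _ pq] := conj_exponent.
rewrite normc_dualpow 1?ltnW // -powR_mulrn ?normc_ge0 // -powRrM.
by rewrite subn1 pq powR_mulrn ?normc_ge0.
Qed.

End Young.
End Complex.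

(** * Averages over the circle *)

Section Average.
Context {R : realType}.
Local Notation mu := (@lebesgue_measure R).
Local Notation D := (@circle R).
Implicit Types (h g : R -> R).

(** The Lebesgue measure lives on [measurableTypeR R], whereas measurability of real
    functions refers to the canonical structure on R; the two structures are
    convertible but carry different displays, hence the two versions. *)
Lemma measurable_circle : @measurable _ (measurableTypeR R) D.
Proof. exact: measurable_itv. Qed.
Let measurable_circle' : measurable D.
Proof. exact: measurable_itv. Qed.
Hint Resolve measurable_circle measurable_circle' : core.

Definition circle_integrable h := mu.-integrable D (EFin \o h).

Definition avg h : R := (pi *+ 2)^-1 * \int[mu]_(t in D) h t.

Lemma pi2_gt0 : 0 < pi *+ 2 :> R.
Proof. by rewrite mulrn_wgt0 // pi_gt0. Qed.

Lemma mu_circle : mu D = (pi *+ 2)%:E.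
Proof.
rewrite lebesgue_measure_itv /= lte_fin gtrN ?pi_gt0 //.
by rewrite -EFinB opprK mulr2n.
Qed.

Lemma circle_integrable_cst (c : R) : circle_integrable (cst c).
Proof.
apply/integrableP; split; first exact/measurable_EFinP.
rewrite /= integral_cst // [X in (_ * X)%E](_ : _ = (pi *+ 2)%:E); last exact: mu_circle.
by rewrite -EFinM ltry.
Qed.

Lemma avg_cst (c : R) : avg (fun=> c) = c.
Proof.
rewrite /avg Rintegral_cst // [X in fine X](_ : _ = (pi *+ 2)%:E); last exact: mu_circle.
rewrite /= mulrCA mulVf ?mulr1 //.
by rewrite gt_eqF // pi2_gt0.
Qed.

Lemma circle_integrableD h g : circle_integrable h -> circle_integrable g ->
  circle_integrable (fun t => h t + g t).
Proof. by move=> ih ig; have := integrableD measurable_circle ih ig. Qed.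

Lemma circle_integrableZ (c : R) h : circle_integrable h ->
  circle_integrable (fun t => c * h t).
Proof. by move=> ih; have := integrableZl measurable_circle c ih. Qed.

Lemma avgD h g : circle_integrable h -> circle_integrable g ->
  avg (fun t => h t + g t) = avg h + avg g.
Proof. by move=> ih ig; rewrite /avg RintegralD // mulrDr. Qed.

Lemma avgZ (c : R) h : circle_integrable h -> avg (fun t => c * h t) = c * avg h.
Proof. by move=> ih; rewrite /avg RintegralZl // mulrCA. Qed.

Lemma avgB h g : circle_integrable h -> circle_integrable g ->
  avg (fun t => h t - g t) = avg h - avg g.
Proof. by move=> ih ig; rewrite /avg RintegralB // mulrBr. Qed.

Lemma avg_le h g : circle_integrable h -> circle_integrable g ->
  (forall t, D t -> h t <= g t) -> avg h <= avg g.
Proof.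
move=> ih ig hg; rewrite /avg ler_pM2l ?invr_gt0 ?pi2_gt0 //.
exact: le_Rintegral.
Qed.

Lemma avg_ext h g : (forall t, D t -> h t = g t) -> avg h = avg g.
Proof.
by move=> hg; congr (_ * _); apply: eq_Rintegral => t; rewrite inE => /hg.
Qed.

Lemma integrable_ext h g : (forall t, D t -> h t = g t) ->
  circle_integrable h -> circle_integrable g.
Proof.
move=> hg; apply: eq_integrable => // t; rewrite inE => /hg /= -> //.
Qed.

Lemma avg_ge0 h : (forall t, D t -> 0 <= h t) -> 0 <= avg h.
Proof.
move=> h0; rewrite mulr_ge0 ?invr_ge0 ?(ltW pi2_gt0) //.
exact: Rintegral_ge0.
Qed.

Lemma integrable_dom h g : measurable_fun D h ->
  (forall t, D t -> `|h t| <= g t) -> circle_integrable g -> circle_integrable h.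
Proof.
move=> mh hg; apply: le_integrable => //; first exact/measurable_EFinP.
by move=> t Dt /=; rewrite lee_fin (le_trans (hg _ Dt)) // ler_norm.
Qed.

Lemma integrable_measurable h : circle_integrable h -> measurable_fun D h.
Proof. by case/integrableP => /measurable_EFinP. Qed.

Lemma ae_mono (P Q : R -> Prop) : (forall t, P t -> Q t) ->
  {ae mu, forall t, P t} -> {ae mu, forall t, Q t}.
Proof.
move=> PQ [N [mN N0 sub]]; exists N; split => //.
by apply: subset_trans sub; apply: subsetC => t /= /PQ.
Qed.

Lemma avg_dominated_convergence (h_ : nat -> R -> R) h g :
  (forall n, measurable_fun D (h_ n)) -> measurable_fun D h ->
  circle_integrable g ->
  {ae mu, forall t, D t -> h_ ^~ t @ \oo --> h t /\ forall n, `|h_ n t| <= g t} ->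
  circle_integrable h /\ avg (h_ n) @[n --> \oo] --> avg h.
Proof.
move=> mh_ mh ig H.
have [] := @dominated_convergence _ _ R mu D measurable_circle
  (fun n => EFin \o h_ n) (EFin \o h) (EFin \o g) _ _ _ ig _.
- by move=> n; apply/measurable_EFinP; exact: mh_.
- exact/measurable_EFinP.
- apply: ae_mono H => t /= H Dt; apply/cvg_EFin; last by have [] := H Dt.
  exact: nearW.
- by apply: ae_mono H => t /= H n Dt; rewrite lee_fin; have [_] := H Dt; apply.
move=> ih _ cv; split => //; apply: cvgMr.
apply: fine_cvg; rewrite fineK //; exact: (integrable_fin_num measurable_circle).
Qed.

Implicit Types (f : R -> R[i]).
Definition cintegrable f :=
  circle_integrable (Re \o f) /\ circle_integrable (Im \o f).
Definition cavg f : R[i] := avg (Re \o f) +i* avg (Im \o f).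

Lemma Re_cavg f : Re (cavg f) = avg (fun t => Re (f t)). Proof. by []. Qed.
Lemma Im_cavg f : Im (cavg f) = avg (fun t => Im (f t)). Proof. by []. Qed.

Lemma fourier_coefE f n : fourier_coef f n = cavg (fun t => f t * cis (- (n%:~R * t))).
Proof.
rewrite /fourier_coef /circle_integral; apply: complex_eq.
  by rewrite re_mul /= mul0r subr0.
by rewrite im_mul /= mul0r addr0.
Qed.

Lemma cmeasurable_cst (c : R[i]) : cmeasurable (fun=> c).
Proof. by split; exact: measurable_cst. Qed.

Lemma cmeasurableD f1 f2 : cmeasurable f1 -> cmeasurable f2 ->
  cmeasurable (fun t => f1 t + f2 t).
Proof.
move=> [r1 i1] [r2 i2]; split.
- by under eq_fun do rewrite re_add; exact: measurable_funD.
- by under eq_fun do rewrite im_add; exact: measurable_funD.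
Qed.

Lemma cmeasurableM f1 f2 : cmeasurable f1 -> cmeasurable f2 ->
  cmeasurable (fun t => f1 t * f2 t).
Proof.
move=> [r1 i1] [r2 i2]; split.
- by under eq_fun do rewrite re_mul; apply: measurable_funB; exact: measurable_funM.
- by under eq_fun do rewrite im_mul; apply: measurable_funD; exact: measurable_funM.
Qed.

Lemma cmeasurableJ f : cmeasurable f -> cmeasurable (fun t => conjc (f t)).
Proof.
move=> [r1 i1]; split; first by under eq_fun do rewrite re_conj.
under eq_fun do rewrite im_conj; exact: measurableT_comp.
Qed.

Lemma cmeasurableX f n : cmeasurable f -> cmeasurable (fun t => f t ^+ n).
Proof.
move=> mf; elim: n => [|n IH]; first exact: cmeasurable_cst.
by under [X in cmeasurable X]eq_fun do rewrite exprS; exact: cmeasurableM.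
Qed.

Lemma measurable_normc f : cmeasurable f -> measurable_fun D (fun t => normc (f t)).
Proof.
move=> [r1 i1]; under eq_fun do rewrite normc_sqrt -powR12_sqrt ?addr_ge0 ?sqr_ge0 //.
apply: (measurableT_comp (measurable_powR _)).
by apply: measurable_funD; exact: measurable_funX.
Qed.

Lemma cintegrable_dom f h : cmeasurable f ->
  (forall t, D t -> normc (f t) <= h t) -> circle_integrable h -> cintegrable f.
Proof.
move=> [mr mi] fh ih; split; apply: integrable_dom ih => // t Dt.
- exact: le_trans (abs_Re_le _) (fh _ Dt).
- exact: le_trans (abs_Im_le _) (fh _ Dt).
Qed.

Lemma cintegrable_normc f : cintegrable f -> circle_integrable (fun t => normc (f t)).
Proof.
move=> [ir ii].
apply: (@integrable_dom _ (fun t => `|Re (f t)| + `|Im (f t)|)).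
- by apply: measurable_normc; split; exact: integrable_measurable.
- by move=> t _; rewrite ger0_norm ?normc_ge0 // normc_le.
- by apply: circle_integrableD; apply: integrable_norm.
Qed.

Lemma cintegrable_measurable f : cintegrable f -> cmeasurable f.
Proof. by move=> [/integrable_measurable ? /integrable_measurable ?]. Qed.

Lemma cavg_ext f1 f2 : (forall t, D t -> f1 t = f2 t) -> cavg f1 = cavg f2.
Proof.
by move=> H; congr (_ +i* _); apply: avg_ext => t Dt /=; rewrite H.
Qed.

Lemma cintegrableM f1 f2 (c : R) : cintegrable f1 -> cmeasurable f2 ->
  (forall t, D t -> normc (f2 t) <= c) -> cintegrable (fun t => f1 t * f2 t).
Proof.
move=> i1 m2 b2; apply: (@cintegrable_dom _ (fun t => c * normc (f1 t))).
- exact/cmeasurableM/m2/cintegrable_measurable.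
- by move=> t Dt; rewrite Normc.normcM mulrC ler_wpM2r ?normc_ge0 ?b2.
- exact/circle_integrableZ/cintegrable_normc.
Qed.

Lemma cintegrableZ (c : R[i]) f : cintegrable f -> cintegrable (fun t => c * f t).
Proof.
move=> i1; have H : cintegrable (fun t => f t * c).
  exact: (cintegrableM i1 (cmeasurable_cst c) (c := normc c)).
by under [X in cintegrable X]eq_fun do rewrite mulrC.
Qed.

Lemma cavgD f1 f2 : cintegrable f1 -> cintegrable f2 ->
  cavg (fun t => f1 t + f2 t) = cavg f1 + cavg f2.
Proof.
move=> [r1 i1] [r2 i2]; apply: complex_eq; rewrite ?re_add ?im_add.
- by rewrite Re_cavg -avgD //; apply: avg_ext => t _; rewrite re_add.
- by rewrite Im_cavg -avgD //; apply: avg_ext => t _; rewrite im_add.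
Qed.

Lemma cavgZ (c : R[i]) f : cintegrable f -> cavg (fun t => c * f t) = c * cavg f.
Proof.
move=> [r1 i1]; apply: complex_eq; rewrite ?re_mul ?im_mul.
- rewrite Re_cavg !(avg_ext (h := fun t => Re (c * f t)) (fun t _ => re_mul _ _)).
  by rewrite avgB ?avgZ //; exact: circle_integrableZ.
- rewrite Im_cavg (avg_ext (h := fun t => Im (c * f t)) (fun t _ => im_mul _ _)).
  by rewrite avgD ?avgZ //; exact: circle_integrableZ.
Qed.

Lemma ae_eq_avg h g : measurable_fun D h -> measurable_fun D g ->
  ae_eq mu D h g -> avg h = avg g.
Proof.
move=> mh mg hg; congr (_ * fine _); apply: ae_eq_integral => //.
- exact/measurable_EFinP.
- exact/measurable_EFinP.
- by apply: ae_mono hg => t /= hg Dt; rewrite hg.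
Qed.

Lemma ae_eq_cavg f1 f2 : cmeasurable f1 -> cmeasurable f2 ->
  ae_eq mu D f1 f2 -> cavg f1 = cavg f2.
Proof.
move=> [r1 i1] [r2 i2] e; congr (_ +i* _); apply: ae_eq_avg => //;
  by apply: ae_mono e => t /= e Dt; rewrite e.
Qed.

Lemma avg_eq0_ae h : (forall t, D t -> 0 <= h t) ->
  circle_integrable h -> avg h = 0 -> ae_eq mu D h (cst 0).
Proof.
move=> h0 ih a0.
have mh : measurable_fun (D : set (measurableTypeR R)) (EFin \o h).
  by case/integrableP : (ih).
have z : (\int[mu]_(t in D) `|(EFin \o h) t| = 0)%E.
  under eq_integral => t tD do
    [rewrite gee0_abs; last by rewrite lee_fin h0 //; exact: set_mem].
  move: a0 => /eqP; rewrite mulf_eq0 invr_eq0 (gt_eqF pi2_gt0) /= => /eqP e.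
  have := integrable_fin_num measurable_circle ih; move/fineK => /= <-.
  by congr (_%:E).
have := (ae_eq_integral_abs mu measurable_circle mh).1 z.
by apply: ae_mono => t /= H Dt; case: (H Dt).
Qed.

End Average.

(** * Orthogonality of the characters *)

Section Trig.
Context {R : realType}.
Local Notation mu := (@lebesgue_measure R).
Local Notation D := (@circle R).
Implicit Types (s : seq (int * R[i])) (n : int) (t : R).

Lemma cisD (x y : R) : cis (x + y) = cis x * cis y.
Proof.
by apply: complex_eq; rewrite ?re_mul ?im_mul /= ?cosD ?sinD //; ring.
Qed.

Lemma cis0 : cis (0 : R) = 1.
Proof. by apply: complex_eq; rewrite /= ?cos0 ?sin0. Qed.

Lemma cis_conj (x : R) : conjc (cis x) = cis (- x).
Proof. by apply: complex_eq; rewrite /= ?cosN ?sinN. Qed.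

Lemma normc_cis (x : R) : normc (cis x) = 1.
Proof. by rewrite /= cos2Dsin2 sqrtr1. Qed.

Lemma measurable_scaling (a : R) : measurable_fun D (fun t => a * t).
Proof. by apply: measurable_funM => //; exact: measurable_cst. Qed.

Lemma cmeasurable_cis (a : R) : cmeasurable (fun t => cis (a * t)).
Proof.
split.
- apply: (@measurableT_comp _ _ _ _ _ _ (@cos R)); last exact: measurable_scaling.
  by apply: continuous_measurable_fun; exact: continuous_cos.
- apply: (@measurableT_comp _ _ _ _ _ _ (@sin R)); last exact: measurable_scaling.
  by apply: continuous_measurable_fun; exact: continuous_sin.
Qed.

Lemma cintegrable_cis (a : R) : cintegrable (fun t => cis (a * t)).
Proof.
apply: (@cintegrable_dom _ _ (cst 1) (cmeasurable_cis a)); last exact: circle_integrable_cst.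
by move=> t _; rewrite normc_cis.
Qed.

Lemma avg_FTC (f F : R -> R) : continuous f -> (forall x : R, is_derive x (1 : R) F (f x)) ->
  circle_integrable f -> avg f = (pi *+ 2)^-1 * (F pi - F (- pi)).
Proof.
move=> cf dF fi; congr (_ * _).
rewrite /circle Rintegral_itv_bndo_bndc // /Rintegral.
rewrite (@continuous_FTC2 _ f F) //.
- by rewrite gtrN ?pi_gt0.
- exact: continuous_subspaceT.
- have cF : continuous F.
    by move=> x; apply/differentiable_continuous/derivable1_diffP; apply: ex_derive.
  split=> [x _||]; first exact: ex_derive.
  + exact/cvg_at_right_filter/cF.
  + exact/cvg_at_left_filter/cF.
- by move=> x _; rewrite derive1E; apply: derive_val.
Qed.

Lemma is_derive_scaling (a x : R) : is_derive x (1 : R) (fun t : R => a * t) a.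
Proof.
have := is_deriveZ a (is_derive_id x (1 : R)).
by rewrite /GRing.scale /= mulr1.
Qed.

Lemma sin_intpi n : sin (n%:~R * pi) = 0 :> R.
Proof.
have H (k : nat) : sin (k%:R * pi) = 0 :> R.
  elim: k => [|k IH]; first by rewrite mul0r sin0.
  by rewrite -natr1 mulrDl mul1r sinDpi IH oppr0.
case: n => k; first exact: H.
by rewrite NegzE mulrNz mulNr sinN H oppr0.
Qed.

Lemma cavg_cis n : cavg (fun t => cis (n%:~R * t)) = (n == 0)%:R.
Proof.
have [->|n0] := eqVneq n 0.
  rewrite (@cavg_ext _ _ (fun=> 1)); last by move=> t _; rewrite mul0r cis0.
  by apply: complex_eq; rewrite ?Re_cavg ?Im_cavg avg_cst.
set a : R := n%:~R.
have a0 : a != 0 by rewrite intr_eq0.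
have [ic is_] := cintegrable_cis a.
apply: complex_eq; rewrite ?Re_cavg ?Im_cavg /=.
- have dF (x : R) : is_derive x (1 : R) (fun t => a^-1 * sin (a * t)) (cos (a * x)).
    have := is_deriveZ a^-1 (is_derive1_comp (is_derive_sin (a * x)) (is_derive_scaling a x)).
    by rewrite /GRing.scale /= mulrCA mulVf // mulr1.
  rewrite (avg_FTC _ dF ic); last first.
    move=> x; apply: continuous_comp; last exact: continuous_cos.
    exact: mulrl_continuous.
  by rewrite mulrN sinN sin_intpi oppr0 subrr mulr0.
- have dF (x : R) : is_derive x (1 : R) (fun t => - (a^-1 * cos (a * t))) (sin (a * x)).
    have := is_deriveN (is_deriveZ a^-1
      (is_derive1_comp (is_derive_cos (a * x)) (is_derive_scaling a x))).
    by rewrite /GRing.scale /= mulrCA mulVf // mulr1 opprK.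
  rewrite (avg_FTC _ dF is_); last first.
    move=> x; apply: continuous_comp; last exact: continuous_sin.
    exact: mulrl_continuous.
  by rewrite mulrN cosN subrr mulr0.
Qed.

End Trig.

(** * Trigonometric polynomials as lists of coefficients *)

Section TrigPoly.
Context {R : realType}.
Local Notation D := (@circle R).
Notation tpoly := (seq (int * R[i])).
Implicit Types (s : tpoly) (n m : int) (t : R).
Local Arguments conjc : simpl never.
Local Arguments cis : simpl never.

(** A list of pairs (frequency, coefficient) stands for a trigonometric polynomial.
    Frequencies may be repeated: sums are then concatenations, products need no
    regrouping, and nonnegativity of the entries is preserved by both. *)
Definition trig s t : R[i] := \sum_(x <- s) x.2 * cis (x.1%:~R * t).
Definition tcoef s n : R[i] := \sum_(x <- s | x.1 == n) x.2.
Definition tmul s1 s2 : tpoly :=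
  [seq (x.1 + y.1, x.2 * y.2) | x <- s1, y <- s2].
Definition tconj s : tpoly := [seq (- x.1, conjc x.2) | x <- s].
Definition texp s k : tpoly := iter k (tmul s) [:: (0, 1)].
Definition tabs s : tpoly := [seq (x.1, `|x.2|) | x <- s].
Definition tdual j s : tpoly := tmul (texp (tconj s) (j - 1)) (texp s j).
Definition tnonneg s := all (fun x => 0 <= x.2) s.

Lemma trig_cat s1 s2 t : trig (s1 ++ s2) t = trig s1 t + trig s2 t.
Proof. by rewrite /trig big_cat. Qed.

Lemma trig1 n c t : trig [:: (n, c)] t = c * cis (n%:~R * t).
Proof. by rewrite /trig big_seq1. Qed.

Lemma trig_mul s1 s2 t : trig (tmul s1 s2) t = trig s1 t * trig s2 t.
Proof.
rewrite /trig big_allpairs_dep mulr_suml; apply: eq_bigr => x _.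
rewrite mulr_sumr; apply: eq_bigr => y _ /=.
by rewrite intrD mulrDl cisD mulrACA.
Qed.

Lemma trig_conj s t : trig (tconj s) t = conjc (trig s t).
Proof.
rewrite /trig big_map rmorph_sum; apply: eq_bigr => x _ /=.
by rewrite rmorphM /= cis_conj mulrNz mulNr.
Qed.

Lemma trig_exp s k t : trig (texp s k) t = trig s t ^+ k.
Proof.
elim: k => [|k IH]; first by rewrite trig1 mul0r cis0 mulr1 expr0.
by rewrite /texp iterS trig_mul IH exprS.
Qed.

Lemma trig_dual j s t : trig (tdual j s) t = dualpow j (trig s t).
Proof. by rewrite trig_mul !trig_exp trig_conj. Qed.

Lemma cmeasurable_trig s : cmeasurable (trig s).
Proof.
elim: s => [|x s IH]; rewrite /trig.
  by under [X in cmeasurable X]eq_fun do rewrite big_nil; exact: cmeasurable_cst.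
under [X in cmeasurable X]eq_fun do rewrite big_cons.
apply: cmeasurableD IH; apply: cmeasurableM; first exact: cmeasurable_cst.
exact: cmeasurable_cis.
Qed.

Lemma normc_trig_le s t : normc (trig s t) <= \sum_(x <- s) normc x.2.
Proof.
rewrite /trig; elim: s => [|x s IH]; first by rewrite !big_nil Normc.normc0.
rewrite !big_cons (le_trans (normc_triangle _ _)) // lerD //.
by rewrite Normc.normcM normc_cis mulr1.
Qed.

Lemma cintegrable_trig s : cintegrable (trig s).
Proof.
apply: cintegrable_dom (cmeasurable_trig s) (fun t _ => normc_trig_le s t) _.
exact: circle_integrable_cst.
Qed.

Lemma cavg_trig s : cavg (trig s) = tcoef s 0.
Proof.
rewrite /tcoef; elim: s => [|x s IH].
  rewrite big_nil (@cavg_ext _ _ (fun=> 0)); last by move=> t _; rewrite /trig big_nil.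
  by apply: complex_eq; rewrite ?Re_cavg ?Im_cavg avg_cst.
rewrite (@cavg_ext _ _ (fun t => x.2 * cis (x.1%:~R * t) + trig s t)); last first.
  by move=> t _; rewrite /trig big_cons.
have ic := cintegrable_cis (R := R) x.1%:~R.
rewrite (cavgD (cintegrableZ x.2 ic) (cintegrable_trig s)) cavgZ // cavg_cis IH.
by rewrite big_cons; case: eqP => _; rewrite ?mulr1 // mulr0 add0r.
Qed.

Lemma tcoef_shift s n m : tcoef (tmul s [:: (n, 1)]) m = tcoef s (m - n).
Proof.
rewrite /tcoef big_mkcond big_allpairs_dep [in RHS]big_mkcond.
by apply: eq_bigr => x _; rewrite big_seq1 /= mulr1 eq_sym -subr_eq eq_sym.
Qed.

Lemma fourier_trig s n : fourier_coef (trig s) n = tcoef s n.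
Proof.
rewrite fourier_coefE (@cavg_ext _ _ (trig (tmul s [:: (- n, 1)]))).
  by rewrite cavg_trig tcoef_shift sub0r opprK.
by move=> t _; rewrite trig_mul trig1 mul1r mulrNz mulNr.
Qed.

Lemma cavg_pair (h : R -> R[i]) s : cintegrable h ->
  cavg (fun t => h t * conjc (trig s t)) =
  \sum_(x <- s) conjc x.2 * fourier_coef h x.1.
Proof.
move=> ih.
have ihc n : cintegrable (fun t => h t * cis (- (n%:~R * t))).
  apply: (cintegrableM ih (c := 1)) => [|t _]; last by rewrite normc_cis.
  by under [X in cmeasurable X]eq_fun do rewrite -mulNr; exact: cmeasurable_cis.
elim: s => [|x s IH].
  rewrite big_nil (@cavg_ext _ _ (fun=> 0)).
    by apply: complex_eq; rewrite ?Re_cavg ?Im_cavg avg_cst.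
  by move=> t _; rewrite /trig big_nil conjc0 mulr0.
rewrite big_cons -IH fourier_coefE -cavgZ // -cavgD; first last.
- apply: (cintegrableM ih (c := \sum_(x <- s) normc x.2)) => [|t _].
    exact/cmeasurableJ/cmeasurable_trig.
  by rewrite normc_conj normc_trig_le.
- exact: cintegrableZ.
apply: cavg_ext => t _; rewrite /trig big_cons rmorphD rmorphM /= cis_conj.
by rewrite mulrDr mulrCA.
Qed.

Lemma tnonneg_cat s1 s2 : tnonneg (s1 ++ s2) = tnonneg s1 && tnonneg s2.
Proof. exact: all_cat. Qed.

Lemma tnonneg_mul s1 s2 : tnonneg s1 -> tnonneg s2 -> tnonneg (tmul s1 s2).
Proof.
move=> /allP h1 /allP h2; apply/allP => z /allpairsP[[x y] /= [/h1 x0 /h2 y0 ->]] /=.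
exact: mulr_ge0.
Qed.

Lemma tnonneg_conj s : tnonneg s -> tnonneg (tconj s).
Proof.
by move=> /allP h; apply/allP => _ /mapP[x /h x0 ->] /=; rewrite conj_ge0.
Qed.

Lemma tnonneg_exp s k : tnonneg s -> tnonneg (texp s k).
Proof.
by move=> h; elim: k => [|k IH]; [rewrite /= ler01 | exact: tnonneg_mul].
Qed.

Lemma tnonneg_dual j s : tnonneg s -> tnonneg (tdual j s).
Proof.
by move=> h; apply: tnonneg_mul; apply: tnonneg_exp => //; exact: tnonneg_conj.
Qed.

Lemma tcoef_ge0 s n : tnonneg s -> 0 <= tcoef s n.
Proof.
move=> /allP h; rewrite /tcoef big_seq_cond.
by apply: sumr_ge0 => x /andP[/h].
Qed.

(** Discarding nonnegative terms from the convolution keeps the single product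
    of the n-th and m-th coefficients. *)
Lemma tcoef_mul_ge s1 s2 n m : tnonneg s1 -> tnonneg s2 ->
  tcoef s1 n * tcoef s2 m <= tcoef (tmul s1 s2) (n + m).
Proof.
move=> /allP h1 /allP h2; rewrite /tcoef [leRHS]big_mkcond big_allpairs_dep mulr_suml.
rewrite [leLHS]big_mkcond big_seq [leRHS]big_seq; apply: ler_sum => x /h1 x0.
case: eqP => [->|_]; last first.
  rewrite big_seq sumr_ge0 // => y /h2 y0 /=; case: ifP => // _; exact: mulr_ge0.
rewrite mulr_sumr [leLHS]big_mkcond [leLHS]big_seq [leRHS]big_seq.
apply: ler_sum => y /h2 y0 /=; rewrite (inj_eq (addrI n)).
by case: eqP.
Qed.

Lemma tcoef_conj s n : tcoef (tconj s) (- n) = conjc (tcoef s n).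
Proof.
rewrite /tcoef big_map rmorph_sum /=; apply: eq_bigl => x.
by rewrite eqr_opp.
Qed.

Lemma tcoef_exp_ge s n k : tnonneg s -> tcoef s n ^+ k <= tcoef (texp s k) (n *+ k).
Proof.
move=> h; elim: k => [|k IH]; first by rewrite expr0 mulr0n /tcoef /texp /= big_mkcond big_seq1 eqxx.
rewrite exprS mulrS; apply: le_trans (tcoef_mul_ge _ _ h (tnonneg_exp k h)).
by rewrite ler_wpM2l // tcoef_ge0.
Qed.

(** The frequency n is reached in conj(G)^(j-1) G^j by using n in each of the
    2 j - 1 factors, since -n (j - 1) + n j = n. *)
Lemma tcoef_dual_ge j s n : (0 < j)%N -> tnonneg s ->
  tcoef s n ^+ (2 * j - 1) <= tcoef (tdual j s) n.
Proof.
move=> j0 h; have hc := tnonneg_conj h.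
have e : n = (- n) *+ (j - 1) + n *+ j.
  by rewrite mulNrn -{2}(subnK j0) mulrnDr mulr1n addKr.
have c0 := tcoef_ge0 n h.
rewrite {2}e; apply: le_trans (tcoef_mul_ge _ _ (tnonneg_exp _ hc) (tnonneg_exp _ h)).
have -> : (2 * j - 1 = (j - 1) + j)%N by lia.
rewrite exprD ler_pM ?exprn_ge0 // ?tcoef_exp_ge //.
apply: le_trans (tcoef_exp_ge _ _ hc).
rewrite tcoef_conj -(RRe_real (ger0_real c0)) conjc_real; exact: lexx.
Qed.

Lemma tabs_mul s1 s2 : tabs (tmul s1 s2) = tmul (tabs s1) (tabs s2).
Proof.
rewrite /tabs /tmul map_allpairs allpairs_mapl allpairs_mapr.
by apply: eq_allpairs => x y /=; rewrite normrM.
Qed.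

Lemma tabs_conj s : tabs (tconj s) = tconj (tabs s).
Proof.
rewrite /tabs /tconj -!map_comp; apply: eq_map => x /=.
by rewrite !normr_normc normc_conj conjc_real.
Qed.

Lemma tabs_exp s k : tabs (texp s k) = texp (tabs s) k.
Proof.
elim: k => [|k IH]; first by rewrite /= normr1.
by rewrite /texp !iterS tabs_mul; congr tmul.
Qed.

Lemma tabs_dual j s : tabs (tdual j s) = tdual j (tabs s).
Proof. by rewrite tabs_mul !tabs_exp tabs_conj. Qed.

Lemma norm_tcoef_le s n : `|tcoef s n| <= tcoef (tabs s) n.
Proof. by rewrite /tcoef big_map; exact: ler_norm_sum. Qed.

(** Since the exponent is even, |G|^(2 j) is itself a trigonometric polynomial, and
    its average is its coefficient at 0. *)
Lemma avg_pow_trig j s : (0 < j)%N ->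
  (avg (fun t => normc (trig s t) ^+ (2 * j)))%:C = tcoef (tmul (tdual j s) (tconj s)) 0.
Proof.
move=> j0; rewrite -cavg_trig.
rewrite (@cavg_ext _ _ (fun t => (normc (trig s t) ^+ (2 * j))%:C)).
  by apply: complex_eq => //=; rewrite avg_cst.
by move=> t _; rewrite trig_mul trig_dual trig_conj dualpow_conj.
Qed.

(** The Hardy-Littlewood majorant property for even exponents.  Products of
    coefficient lists commute with taking moduli, so the triangle inequality
    compares the coefficients at 0 of the two 2 j-th powers. *)
Lemma trig_majorant j s : (0 < j)%N ->
  avg (fun t => normc (trig s t) ^+ (2 * j)) <=
  avg (fun t => normc (trig (tabs s) t) ^+ (2 * j)).
Proof.
move=> j0; rewrite -lecR !avg_pow_trig //.
rewrite -tabs_dual -tabs_conj -tabs_mul.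
apply: le_trans (norm_tcoef_le _ _).
rewrite -avg_pow_trig // normr_normc normc_real lecR; exact: ler_norm.
Qed.

End TrigPoly.

(** * Convergence of complex sequences *)

Section Limits.
Context {R : realType}.
Local Notation mu := (@lebesgue_measure R).
Local Notation D := (@circle R).
Implicit Types (u v : nat -> R[i]) (z w : R[i]).

(** Convergence is stated for real and imaginary parts because integrals of complex
    functions are computed componentwise. *)
Definition ccvg u z := Re (u k) @[k --> \oo] --> Re z /\ Im (u k) @[k --> \oo] --> Im z.

Lemma ccvg_cst z : ccvg (fun=> z) z.
Proof. by split; exact: cvg_cst. Qed.

Lemma ccvgD u v z w : ccvg u z -> ccvg v w -> ccvg (fun k => u k + v k) (z + w).
Proof.
move=> [r1 i1] [r2 i2]; split; rewrite ?re_add ?im_add.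
- by under eq_fun do rewrite re_add; exact: cvgD.
- by under eq_fun do rewrite im_add; exact: cvgD.
Qed.

Lemma ccvgM u v z w : ccvg u z -> ccvg v w -> ccvg (fun k => u k * v k) (z * w).
Proof.
move=> [r1 i1] [r2 i2]; split; rewrite ?re_mul ?im_mul.
- by under eq_fun do rewrite re_mul; apply: cvgB; exact: cvgM.
- by under eq_fun do rewrite im_mul; apply: cvgD; exact: cvgM.
Qed.

Lemma ccvgJ u z : ccvg u z -> ccvg (fun k => conjc (u k)) (conjc z).
Proof.
move=> [r1 i1]; split; rewrite ?re_conj ?im_conj.
- by under eq_fun do rewrite re_conj.
- by under eq_fun do rewrite im_conj; exact: cvgN.
Qed.

Lemma ccvgX u z n : ccvg u z -> ccvg (fun k => u k ^+ n) (z ^+ n).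
Proof.
move=> uz; elim: n => [|n IH]; first exact: ccvg_cst.
by rewrite exprS; under [X in ccvg X]eq_fun do rewrite exprS; exact: ccvgM.
Qed.

Lemma ccvg_real (x : nat -> R) (l : R) :
  x k @[k --> \oo] --> l -> ccvg (fun k => (x k)%:C) l%:C.
Proof. by move=> xl; split => //=; exact: cvg_cst. Qed.

Lemma ccvg_normc_pow u z j : ccvg u z ->
  normc (u k) ^+ (2 * j) @[k --> \oo] --> normc z ^+ (2 * j).
Proof.
move=> uz; have [+ _] := ccvgX j (ccvgM uz (ccvgJ uz)).
have E (x : R[i]) : Re ((x * conjc x) ^+ j) = normc x ^+ (2 * j).
  by rewrite mul_conj exprM -rmorphXn.
by rewrite E; under eq_fun do rewrite E.
Qed.

Lemma ccvg_ge0 u z : (forall k, 0 <= u k) -> ccvg u z -> 0 <= z.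
Proof.
move=> u0 [r1 i1]; rewrite lecE /=.
have h k := u0 k; have re0 k : 0 <= Re (u k) by have := h k; rewrite lecE => /andP[].
have im0 k : Im (u k) = 0 by have := h k; rewrite lecE => /andP[/eqP].
apply/andP; split.
  move: i1; under eq_fun do rewrite im0.
  by move=> /(cvg_unique (@norm_hausdorff _ R^o)) i1; apply/eqP/i1; exact: cvg_cst.
rewrite -(cvg_lim _ r1) //; apply: limr_ge; first by apply/cvg_ex; exists (Re z).
exact: nearW.
Qed.

Lemma cavg_dominated_convergence (f_ : nat -> R -> R[i]) f (g : R -> R) :
  (forall k, cmeasurable (f_ k)) -> cmeasurable f -> circle_integrable g ->
  {ae mu, forall t, D t -> ccvg (f_ ^~ t) (f t) /\ forall k, normc (f_ k t) <= g t} ->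
  cintegrable f /\ ccvg (fun k => cavg (f_ k)) (cavg f).
Proof.
move=> mf_ [mr mi] ig H.
have [ir cr] : circle_integrable (Re \o f) /\
    avg (Re \o f_ k) @[k --> \oo] --> avg (Re \o f).
  apply: (avg_dominated_convergence _ mr ig) => [k|]; first exact: (mf_ k).1.
  apply: ae_mono H => t H Dt; have [[cr _] b] := H Dt; split => // k.
  exact: le_trans (abs_Re_le _) (b k).
have [ii ci] : circle_integrable (Im \o f) /\
    avg (Im \o f_ k) @[k --> \oo] --> avg (Im \o f).
  apply: (avg_dominated_convergence _ mi ig) => [k|]; first exact: (mf_ k).2.
  apply: ae_mono H => t H Dt; have [[_ ci] b] := H Dt; split => // k.
  exact: le_trans (abs_Im_le _) (b k).
by split.
Qed.

Lemma fast_cauchy (x : nat -> R) (c : R) :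
  (forall k, `|x k.+1 - x k| <= c * 2^-1 ^+ k) -> cvgn x.
Proof.
move=> h.
have c0 : 0 <= c by have := h 0%N; rewrite expr0 mulr1; apply: le_trans.
have : cvgn (series (telescope x)).
  apply: normed_cvg.
  apply: (@series_le_cvg _ _ (geometric c 2^-1)).
  - by move=> n /=.
  - by move=> n /=; rewrite mulr_ge0 // exprn_ge0.
  - by move=> n; exact: h.
  - by apply: is_cvg_geometric_series; rewrite ger0_norm ?invr_ge0 // invf_lt1 // ltr1n.
rewrite telescopeK => cv.
have [l xl] := (cvg_ex _).1 cv; apply/cvg_ex; exists (l + x 0%N).
have := cvgD xl (cvg_cst (x 0%N)); rewrite [X in X @ _](_ : _ = x); last first.
  by apply/funext => n; rewrite fctE /= subrK.
by move=> cvg_x; exact: cvg_x.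
Qed.

(** The constant 2 is the sum of the geometric series that controls the increments. *)
Lemma fast_cauchy_bound (u : nat -> R[i]) (c : R) :
  (forall k, normc (u k - u k.+1) <= c * 2^-1 ^+ k) ->
  exists z, ccvg u z /\ forall k, normc (u k) <= normc (u 0%N) + 2 * c.
Proof.
move=> h; have h' k : normc (u k.+1 - u k) <= c * 2^-1 ^+ k.
  by rewrite -normc_opp opprB.
have c0 : 0 <= c by have := h 0%N; rewrite expr0 mulr1 => /(le_trans (normc_ge0 _)).
have cr : cvgn (Re \o u).
  apply: (@fast_cauchy _ c) => k /=; rewrite -re_opp -re_add.
  exact: le_trans (abs_Re_le _) (h' k).
have ci : cvgn (Im \o u).
  apply: (@fast_cauchy _ c) => k /=; rewrite -im_opp -im_add.
  exact: le_trans (abs_Im_le _) (h' k).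
exists (limn (Re \o u) +i* limn (Im \o u)); split; first by split.
move=> k; apply: le_trans (_ : normc (u 0%N) + 2 * c * (1 - 2^-1 ^+ k) <= _).
  elim: k => [|k IH]; first by rewrite expr0 subrr mulr0 addr0.
  rewrite -[u k.+1](subrK (u k)) (le_trans (normc_triangle _ _)) //.
  by move: (h' k) IH; rewrite exprS => *; lra.
rewrite lerD2l -[leRHS]mulr1 ler_wpM2l ?mulr_ge0 // lerBlDr lerDl.
Qed.

End Limits.

(** * Completeness along fast Cauchy sequences *)

Section RieszFischer.
Context {R : realType}.
Local Notation mu := (@lebesgue_measure R).
Local Notation D := (@circle R).

Lemma integral_avg (h : R -> R) : circle_integrable h ->
  (\int[mu]_(t in D) (h t)%:E)%E = (pi *+ 2 * avg h)%:E.
Proof.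
move=> ih; rewrite /avg mulrA divff ?mul1r ?gt_eqF ?pi2_gt0 //.
by rewrite fineK //; exact: (integrable_fin_num (measurable_circle (R := R)) ih).
Qed.

Lemma geometric_half_le (c : R) n : 0 <= c -> \sum_(0 <= k < n) c * 2^-1 ^+ k <= 2 * c.
Proof.
move=> c0; apply: le_trans (_ : 2 * c * (1 - 2^-1 ^+ n) <= _).
  elim: n => [|n IH]; first by rewrite big_nil expr0 subrr mulr0.
  by rewrite big_nat_recr //= exprS; move: IH => *; lra.
by rewrite -[leRHS]mulr1 ler_wpM2l ?mulr_ge0 // lerBlDr lerDl exprn_ge0.
Qed.

Lemma series_integrable (u : nat -> R -> R) (c : R) :
  0 <= c ->
  (forall k t, 0 <= u k t) -> (forall k, circle_integrable (u k)) ->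
  (forall k, avg (u k) <= c * 2^-1 ^+ k) ->
  mu.-integrable D (fun t => \sum_(k <oo) (u k t)%:E)%E.
Proof.
move=> c0 u0 iu ub.
have mu_ k : measurable_fun (D : set (measurableTypeR R)) (EFin \o u k).
  by case/integrableP : (iu k).
apply/integrableP; split.
  apply: (@ge0_emeasurable_sum _ _ _ _ (fun k t => (u k t)%:E) xpredT).
    by move=> k t _ _; rewrite lee_fin.
  by move=> k _; exact: mu_.
under eq_integral => t _ do
  (rewrite gee0_abs; last by apply: nneseries_ge0 => k _ _; rewrite lee_fin).
rewrite integral_nneseries //; first last.
- by move=> k t _; rewrite lee_fin.
- exact: measurable_circle.
apply: (@le_lt_trans _ _ (pi *+ 2 * (2 * c))%:E); last exact: ltry.
apply: lime_le.
  by apply: is_cvg_nneseries => k _ _; apply: integral_ge0 => t _; rewrite lee_fin.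
apply: nearW => n.
rewrite (eq_bigr (fun k => (pi *+ 2 * avg (u k))%:E)); last first.
  by move=> k _; exact: integral_avg.
rewrite sumEFin lee_fin -mulr_sumr ler_pM2l ?pi2_gt0 //.
by apply: le_trans (geometric_half_le n c0); apply: ler_sum.
Qed.

(** The weighted sum S of 2^(k q) |g_k - g_(k+1)|^q is integrable, hence finite almost
    everywhere, and where it is finite |g_k - g_(k+1)| <= S^(1/q) 2^(-k).  This gives
    convergence and the bound B + 2 S^(1/q), whose q-th power is integrable. *)
Lemma fast_limit (g_ : nat -> R -> R[i]) (q : nat) (c B : R) :
  (0 < q)%N -> 0 <= c -> 1 <= B ->
  (forall k, cmeasurable (g_ k)) -> (forall t, normc (g_ 0%N t) <= B) ->
  (forall k, circle_integrable (fun t => normc (g_ k t - g_ k.+1 t) ^+ q)) ->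
  (forall k, avg (fun t => normc (g_ k t - g_ k.+1 t) ^+ q) <=
    c * 2^-1 ^+ (k * q.+1)) ->
  exists G M, [/\ cmeasurable G, forall t, 1 <= M t,
    circle_integrable (fun t => M t ^+ q) &
    {ae mu, forall t, D t -> ccvg (g_ ^~ t) (G t) /\
       forall k, normc (g_ k t) <= M t}].
Proof.
move=> even_exponent_gt0 c0 B1 mg gB id_ ad.
pose d k t := normc (g_ k t - g_ k.+1 t).
pose u k t := 2 ^+ (k * q) * d k t ^+ q.
have u0 k t : 0 <= u k t by rewrite mulr_ge0 ?exprn_ge0 ?normc_ge0.
have iu k : circle_integrable (u k) by exact: (circle_integrableZ (2 ^+ (k * q)) (id_ k)).
have ub k : avg (u k) <= c * 2^-1 ^+ k.
  rewrite (avgZ _ (id_ k)).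
  apply: le_trans (ler_wpM2l _ (ad k)) _; first by rewrite exprn_ge0.
  rewrite mulrCA ler_wpM2l // mulnS addnC exprD mulrA -exprMn divff //.
  by rewrite expr1n mul1r.
pose S t : \bar R := (\sum_(k <oo) (u k t)%:E)%E.
have iS : mu.-integrable D S by exact: series_integrable ub.
have ifS : circle_integrable (fun t => fine (S t)).
  apply: (le_integrable (measurable_circle (R := R)) _ _ iS).
    apply: measurableT_comp => //; apply: measurableT_comp => //.
    by case/integrableP: iS.
  move=> t _; rewrite /comp; case: (S t) => //=; rewrite ?normr0; exact: leey.
have S0 t : (0 <= S t)%E by apply: nneseries_ge0 => k _ _; rewrite lee_fin.
pose s t := fine (S t) `^ q%:R^-1.
have s0 t : 0 <= s t by exact: powR_ge0.
have sq t : s t ^+ q = fine (S t).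
  rewrite -powR_mulrn // -powRrM mulVf ?pnatr_eq0 -?lt0n // powRr1 // fine_ge0 //.
have ds t : S t \is a fin_num -> forall k, d k t <= s t * 2^-1 ^+ k.
  move=> Sf k; rewrite -(@ler_pXn2r _ q) ?nnegrE ?mulr_ge0 ?exprn_ge0 ?normc_ge0 //.
  rewrite exprMn sq -exprM exprVn ler_pdivlMr ?exprn_gt0 // mulrC.
  rewrite -lee_fin fineK // /S.
  have := @nneseries_lim_ge _ (fun k => (u k t)%:E) xpredT 0 k.+1.
  move=> /(_ (fun n _ _ => u0 n t)); apply: le_trans.
  rewrite big_nat_recr //= leeDr // sume_ge0 // => n _; by rewrite lee_fin.
pose A := D `&` [set t | S t \is a fin_num].
have mA : @measurable _ (measurableTypeR R) A.
  by apply: emeasurable_fin_num; [exact: measurable_circle|case/integrableP: iS].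
(* Cutting off the null set where S is infinite makes the sequence converge
   everywhere, which gives a measurable limit. *)
pose h k t := g_ k t * (\1_A t)%:C.
have mh k : cmeasurable (h k).
  by apply: cmeasurableM => //; split => /=; [exact: measurable_indic|exact: measurable_cst].
have hcv t : D t -> exists z, ccvg (h ^~ t) z.
  move=> Dt; have [Sf|Sf] := boolP (S t \is a fin_num).
    have [z [cz _]] := fast_cauchy_bound (ds t Sf); exists z.
    rewrite /h indicE mem_set //=.
    by under [X in ccvg X]eq_fun do rewrite mulr1.
  exists 0; rewrite /h indicE memNset /=; last by move=> [_] /=; exact/negP.
  by under [X in ccvg X]eq_fun do rewrite mulr0; exact: ccvg_cst.
have /choice [G HG] : forall t, exists z, D t -> ccvg (h ^~ t) z.
  move=> t; have [Dt|Dt] := pselect (D t); last by exists 0.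
  by have [z hz] := hcv t Dt; exists z.
exists G, (fun t => B + 2 * s t); split.
- split.
  + apply: (@measurable_fun_cvg _ _ _ _ (fun k t => Re (h k t))) => [k|t Dt].
      exact: (mh k).1.
    exact: (HG t Dt).1.
  + apply: (@measurable_fun_cvg _ _ _ _ (fun k t => Im (h k t))) => [k|t Dt].
      exact: (mh k).2.
    exact: (HG t Dt).2.
- by move=> t; rewrite (le_trans B1) // lerDl mulr_ge0.
- have ms : measurable_fun D s.
    apply: (measurableT_comp (measurable_powR _)). exact: (integrable_measurable ifS).
  apply: (@integrable_dom _ _ (fun t => 2 ^+ q * (B ^+ q + 2 ^+ q * fine (S t)))).
  + apply: measurable_funX; apply: measurable_funD => //; exact: measurable_funM.
  + move=> t _; have Bs : 0 <= B + 2 * s t by rewrite addr_ge0 ?mulr_ge0 // (le_trans _ B1).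
    rewrite ger0_norm ?exprn_ge0 //.
    have B0 := le_trans ler01 B1; have s2 : 0 <= 2 * s t by rewrite mulr_ge0.
    have := midpoint_pow q B0 s2; rewrite exprMn exprVn ler_pdivrMr ?exprn_gt0 //.
    rewrite [(2 * s t) ^+ q]exprMn sq => /le_trans -> //.
    rewrite mulrC ler_wpM2l ?exprn_ge0 // ler_pdivrMr // mulr_natr mulr2n lerDl.
    by rewrite addr_ge0 ?mulr_ge0 ?exprn_ge0 // fine_ge0.
  + apply: circle_integrableZ; apply: circle_integrableD; first exact: circle_integrable_cst.
    exact: circle_integrableZ.
- have := integrable_ae (measurable_circle (R := R)) iS.
  apply: ae_mono => t H Dt; have Sf := H Dt; split.
    have := HG t Dt; rewrite /h indicE mem_set //=.
    by under [X in ccvg X]eq_fun do rewrite mulr1.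
  have [z [_ bz]] := fast_cauchy_bound (ds t Sf).
  by move=> k; rewrite (le_trans (bz k)) // lerD2r.
Qed.
End RieszFischer.

(** * Norms and Young's inequality on the circle *)

Section LpNorm.
Context {R : realType}.
Local Notation mu := (@lebesgue_measure R).
Local Notation D := (@circle R).

Lemma circle_norm_avg (r : R) (h : R -> R[i]) :
  circle_integrable (fun t => normc (h t) `^ r) ->
  circle_norm r h = (avg (fun t => normc (h t) `^ r) `^ r^-1)%:E.
Proof.
move=> ih; rewrite /circle_norm integral_avg // -EFinM mulKf ?gt_eqF ?pi2_gt0 //.
Qed.

Lemma circle_Lp_integrable (r : R) (h : R -> R[i]) : 0 < r -> circle_Lp r h ->
  circle_integrable (fun t => normc (h t) `^ r).
Proof.
move=> r0 [mh]; rewrite /circle_norm => /lty_poweRy; rewrite invr_eq0 gt_eqF // => /(_ isT) H.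
apply/integrableP; split.
  apply/measurable_EFinP.
  exact: (measurableT_comp (measurable_powR _) (measurable_normc mh)).
under eq_integral => t _ do rewrite /= ger0_norm ?powR_ge0 //.
move: H; set I := integral _ _ _.
have : (0 <= I)%E by apply: integral_ge0 => t _; rewrite lee_fin powR_ge0.
case: I => [x _ _||//]; first exact: ltry.
by rewrite gt0_muley // lte_fin invr_gt0 pi2_gt0.
Qed.

Lemma circle_LpP (r : R) (h : R -> R[i]) : cmeasurable h ->
  circle_integrable (fun t => normc (h t) `^ r) -> circle_Lp r h.
Proof. by move=> mh ih; split=> //; rewrite circle_norm_avg // ltry. Qed.

Lemma le_circle_norm (r : R) (h1 h2 : R -> R[i]) : 0 < r ->
  circle_integrable (fun t => normc (h1 t) `^ r) ->
  circle_integrable (fun t => normc (h2 t) `^ r) ->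
  (circle_norm r h1 <= circle_norm r h2)%E =
  (avg (fun t => normc (h1 t) `^ r) <= avg (fun t => normc (h2 t) `^ r)).
Proof.
move=> r0 i1 i2; rewrite !circle_norm_avg // lee_fin.
have a0 h : 0 <= avg (fun t => normc (h t) `^ r) by apply: avg_ge0 => t _; exact: powR_ge0.
have ri : 0 < r^-1 by rewrite invr_gt0.
apply/idP/idP; last by apply: ge0_ler_powR; rewrite ?nnegrE // ltW.
by apply: contraLR; rewrite -!ltNge => lt; apply: gt0_ltr_powR; rewrite ?nnegrE.
Qed.

End LpNorm.

Section Young.
Context {R : realType}.
Local Notation mu := (@lebesgue_measure R).
Local Notation D := (@circle R).
Variables (j : nat) (p : R).
Hypotheses (hj : (1 < j)%N) (hp : p = (2 * j)%:R / (2 * j - 1)%:R).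
Let q := (2 * j)%N.

Definition young_bound (x y : R) := y ^+ q / q%:R + (1 - q%:R^-1) * x `^ p.

Lemma even_exponent_gt0 : (0 < q)%N. Proof. by rewrite /q muln_gt0 (ltnW hj). Qed.
Lemma even_exponentR_gt0 : 0 < q%:R :> R. Proof. by rewrite ltr0n even_exponent_gt0. Qed.
Lemma conj_weight_gt0 : 0 < 1 - q%:R^-1 :> R.
Proof. by rewrite subr_gt0 invf_lt1 ?even_exponentR_gt0 // ltr1n /q mul2n -addnn ltn_addr. Qed.

(** An upper bound of x by a proper weighted mean of x and y is an upper bound by y;
    this is how norm inequalities come out of Young's inequality. *)
Lemma le_of_le_mean (x y : R) :
  x <= x / q%:R + (1 - q%:R^-1) * y -> x <= y.
Proof.
move=> h; rewrite -(ler_pM2l conj_weight_gt0) mulrBl mul1r lerBlDl.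
by rewrite [q%:R^-1 * x]mulrC.
Qed.

Lemma young_mul (x y : R) : 0 <= x -> 0 <= y -> x * y <= young_bound x y.
Proof.
move=> x0 y0; have [+ _] := young_dual hj hp x%:C y%:C.
by rewrite !normc_real !ger0_norm // conjc_real -rmorphM.
Qed.

Lemma integrable_young (h g : R -> R[i]) :
  circle_integrable (fun t => normc (h t) `^ p) ->
  circle_integrable (fun t => normc (g t) ^+ q) ->
  circle_integrable (fun t => young_bound (normc (h t)) (normc (g t))).
Proof.
move=> ih ig; apply: circle_integrableD; last exact: circle_integrableZ.
by apply: integrable_ext (circle_integrableZ q%:R^-1 ig) => t _; rewrite mulrC.
Qed.

Lemma avg_young_bound (h g : R -> R[i]) :
  circle_integrable (fun t => normc (h t) `^ p) ->
  circle_integrable (fun t => normc (g t) ^+ q) ->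
  avg (fun t => young_bound (normc (h t)) (normc (g t))) =
  avg (fun t => normc (g t) ^+ q) / q%:R + (1 - q%:R^-1) * avg (fun t => normc (h t) `^ p).
Proof.
move=> ih ig; rewrite (avg_ext (g := fun t => q%:R^-1 * normc (g t) ^+ q +
  (1 - q%:R^-1) * normc (h t) `^ p)); last first.
  by move=> t _; rewrite /young_bound mulrC.
by rewrite avgD ?avgZ //; [rewrite mulrC | exact: circle_integrableZ | exact: circle_integrableZ].
Qed.

Lemma cintegrable_pair (h g : R -> R[i]) : cmeasurable h -> cmeasurable g ->
  circle_integrable (fun t => normc (h t) `^ p) ->
  circle_integrable (fun t => normc (g t) ^+ q) ->
  cintegrable (fun t => h t * conjc (g t)).
Proof.
move=> mh mg ih ig; apply: cintegrable_dom (integrable_young ih ig).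
  exact/(cmeasurableM mh)/cmeasurableJ.
by move=> t _; rewrite Normc.normcM normc_conj young_mul ?normc_ge0.
Qed.

Lemma cintegrable_Lp (h : R -> R[i]) : cmeasurable h ->
  circle_integrable (fun t => normc (h t) `^ p) -> cintegrable h.
Proof.
move=> mh ih.
have H : cintegrable (fun t => h t * conjc ((fun=> 1) t)).
  exact: (cintegrable_pair mh (cmeasurable_cst 1) ih (circle_integrable_cst _)).
have E : (fun t => h t * conjc ((fun=> 1) t)) = h by apply/funext => t; rewrite conjc1 mulr1.
by rewrite -E.
Qed.

Lemma avg_pair_le (h g : R -> R[i]) : cmeasurable h -> cmeasurable g ->
  circle_integrable (fun t => normc (h t) `^ p) ->
  circle_integrable (fun t => normc (g t) ^+ q) ->
  Re (cavg (fun t => h t * conjc (g t))) <=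
  avg (fun t => normc (g t) ^+ q) / q%:R + (1 - q%:R^-1) * avg (fun t => normc (h t) `^ p).
Proof.
move=> mh mg ih ig; rewrite -avg_young_bound // Re_cavg; apply: avg_le.
- by have [] := cintegrable_pair mh mg ih ig.
- exact: integrable_young.
- by move=> t _; have [] := young_dual hj hp (h t) (g t).
Qed.

(** The defect in Young's inequality is a nonnegative function of average 0, so it
    vanishes almost everywhere and the pointwise equality case applies. *)
Lemma avg_pair_eq (h g : R -> R[i]) : cmeasurable h -> cmeasurable g ->
  circle_integrable (fun t => normc (h t) `^ p) ->
  circle_integrable (fun t => normc (g t) ^+ q) ->
  Re (cavg (fun t => h t * conjc (g t))) =
  avg (fun t => normc (g t) ^+ q) / q%:R + (1 - q%:R^-1) * avg (fun t => normc (h t) `^ p) ->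
  ae_eq mu D h (fun t => dualpow j (g t)).
Proof.
move=> mh mg ih ig; rewrite -avg_young_bound // Re_cavg => e.
have iy := integrable_young ih ig; have [ip _] := cintegrable_pair mh mg ih ig.
pose d t := young_bound (normc (h t)) (normc (g t)) - Re (h t * conjc (g t)).
have id_ : circle_integrable d.
  apply: integrable_ext (circle_integrableD iy (circle_integrableZ (-1) ip)) => t _.
  by rewrite mulN1r.
have : ae_eq mu D d (cst 0).
  apply: avg_eq0_ae => //.
    by move=> t _; rewrite subr_ge0; have [] := young_dual hj hp (h t) (g t).
  by rewrite avgB // e subrr.
apply: ae_mono => t H Dt; have [_] := young_dual hj hp (h t) (g t); apply.
by have /eqP := H Dt; rewrite subr_eq0 => /eqP <-.
Qed.

End Young.

(** * Dominated limits along a minimizing sequence *)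

Section Controlled.
Context {R : realType}.
Local Notation mu := (@lebesgue_measure R).
Local Notation D := (@circle R).
Variables (j : nat) (p : R).
Hypotheses (hj : (1 < j)%N) (hp : p = (2 * j)%:R / (2 * j - 1)%:R).
Let q := (2 * j)%N.
Variables (g_ : nat -> R -> R[i]) (G : R -> R[i]) (M : R -> R) (K : R).
Let good t := ccvg (g_ ^~ t) (G t) /\ forall k, normc (g_ k t) <= M t.
Hypotheses (mG : cmeasurable G) (M1 : forall t, 1 <= M t) (K1 : 1 <= K)
  (iM : circle_integrable (fun t => M t ^+ q))
  (hgood : {ae mu, forall t, D t -> good t}).

(** Sequences with limit G dominated by K * M wherever g_ itself converges to G and is
    dominated by M.  Small perturbations of a minimizing sequence g_ qualify, with
    the same exceptional null set. *)
Definition controlled (v_ : nat -> R -> R[i]) := (forall k, cmeasurable (v_ k)) /\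
  forall t, good t -> ccvg (v_ ^~ t) (G t) /\ forall k, normc (v_ k t) <= K * M t.

Let KM1 t : 1 <= K * M t.
Proof. by rewrite -[leLHS]mulr1 ler_pM. Qed.

Let iKM : circle_integrable (fun t => (K * M t) ^+ q).
Proof.
by apply: integrable_ext (circle_integrableZ (K ^+ q) iM) => t _; rewrite exprMn.
Qed.

Lemma controlled_avg_pow v_ : controlled v_ ->
  circle_integrable (fun t => normc (G t) ^+ q) /\
  avg (fun t => normc (v_ k t) ^+ q) @[k --> \oo] --> avg (fun t => normc (G t) ^+ q).
Proof.
move=> [mv cv]; apply: (avg_dominated_convergence _ _ iKM) => [k||].
- exact: measurable_funX (measurable_normc (mv k)).
- exact: measurable_funX (measurable_normc mG).
- apply: ae_mono hgood => t H Dt; have [c b] := cv t (H Dt); split.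
    exact: ccvg_normc_pow.
  by move=> k; rewrite ger0_norm ?exprn_ge0 ?normc_ge0 // lerXn2r ?nnegrE ?normc_ge0 //
    (le_trans ler01).
Qed.

Lemma controlled_pair v_ (h : R -> R[i]) : controlled v_ -> cmeasurable h ->
  circle_integrable (fun t => normc (h t) `^ p) ->
  ccvg (fun k => cavg (fun t => h t * conjc (v_ k t))) (cavg (fun t => h t * conjc (G t))).
Proof.
move=> [mv cv] mh ih.
have ib : circle_integrable (fun t => young_bound j p (normc (h t)) (normc ((K * M t)%:C))).
  apply: integrable_young => //.
  apply: integrable_ext iKM => t _; rewrite normc_real ger0_norm //.
  exact: le_trans (KM1 t).
apply: (cavg_dominated_convergence _ _ ib _).2 => [k||].
- exact/(cmeasurableM mh)/cmeasurableJ.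
- exact/(cmeasurableM mh)/cmeasurableJ.
- apply: ae_mono hgood => t H Dt; have [c b] := cv t (H Dt); split.
    by apply: ccvgM; [exact: ccvg_cst | exact: ccvgJ].
  have KM0 := le_trans ler01 (KM1 t).
  move=> k; rewrite Normc.normcM normc_conj normc_real ger0_norm //.
  apply: le_trans (young_mul hj hp (normc_ge0 _) KM0).
  by rewrite ler_wpM2l ?normc_ge0.
Qed.

Lemma controlled_pow_le v_ t m k : controlled v_ -> good t -> (m <= q)%N ->
  normc (v_ k t) ^+ m <= (K * M t) ^+ q.
Proof.
move=> [mv cv] /cv[_ b] mq; apply: (@le_trans _ _ ((K * M t) ^+ m)).
  by rewrite lerXn2r ?nnegrE ?normc_ge0 // (le_trans ler01).
exact: ler_weXn2l.
Qed.

Lemma controlled_fourier v_ n : controlled v_ ->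
  ccvg (fun k => fourier_coef (v_ k) n) (fourier_coef G n).
Proof.
move=> tv; have [mv cv] := tv.
rewrite fourier_coefE; under [X in ccvg X]eq_fun do rewrite fourier_coefE.
have mc : cmeasurable (fun t : R => cis (- (n%:~R * t))).
  by under [X in cmeasurable X]eq_fun do rewrite -mulNr; exact: cmeasurable_cis.
apply: (cavg_dominated_convergence _ _ iKM _).2 => [k||].
- exact: cmeasurableM.
- exact: cmeasurableM.
- apply: ae_mono hgood => t H Dt; have [c b] := cv t (H Dt); split.
    by apply: ccvgM => //; exact: ccvg_cst.
  move=> k; rewrite Normc.normcM normc_cis mulr1 -[leLHS]expr1.
  by apply: controlled_pow_le => //; [exact: H | exact: even_exponent_gt0].
Qed.

Lemma cmeasurable_dualpow (v : R -> R[i]) : cmeasurable v ->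
  cmeasurable (fun t => dualpow j (v t)).
Proof.
move=> mv; apply: cmeasurableM; last exact: cmeasurableX.
exact/cmeasurableX/cmeasurableJ.
Qed.

Lemma ccvg_dualpow (u : nat -> R[i]) (z : R[i]) : ccvg u z -> ccvg (fun k => dualpow j (u k)) (dualpow j z).
Proof. by move=> uz; apply: ccvgM; apply: ccvgX => //; exact: ccvgJ. Qed.

Lemma controlled_fourier_dual v_ n : controlled v_ ->
  ccvg (fun k => fourier_coef (fun t => dualpow j (v_ k t)) n)
       (fourier_coef (fun t => dualpow j (G t)) n).
Proof.
move=> tv; have [mv cv] := tv.
rewrite fourier_coefE; under [X in ccvg X]eq_fun do rewrite fourier_coefE.
have mc : cmeasurable (fun t : R => cis (- (n%:~R * t))).
  by under [X in cmeasurable X]eq_fun do rewrite -mulNr; exact: cmeasurable_cis.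
apply: (cavg_dominated_convergence _ _ iKM _).2 => [k||].
- exact/cmeasurableM/mc/cmeasurable_dualpow.
- exact/cmeasurableM/mc/cmeasurable_dualpow.
- apply: ae_mono hgood => t H Dt; have [c b] := cv t (H Dt); split.
    by apply: ccvgM; [exact: ccvg_dualpow|exact: ccvg_cst].
  move=> k; rewrite Normc.normcM normc_cis mulr1 normc_dualpow 1?ltnW //.
  by apply: controlled_pow_le => //; [exact: H | rewrite leq_subr].
Qed.

Lemma controlled_dual_pair v_ w_ : controlled v_ -> controlled w_ ->
  ccvg (fun k => cavg (fun t => dualpow j (v_ k t) * conjc (w_ k t)))
       (avg (fun t => normc (G t) ^+ q))%:C.
Proof.
move=> tv tw; have [mv cv] := tv; have [mw cw] := tw.
have -> : (avg (fun t => normc (G t) ^+ q))%:C = cavg (fun t => dualpow j (G t) * conjc (G t)).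
  rewrite (@cavg_ext _ _ (fun t => (normc (G t) ^+ q)%:C)).
    by apply: complex_eq => //=; rewrite avg_cst.
  by move=> t _; rewrite dualpow_conj // ltnW.
apply: (cavg_dominated_convergence _ _ iKM _).2 => [k||].
- exact/cmeasurableM/cmeasurableJ/mw/cmeasurable_dualpow.
- exact/cmeasurableM/cmeasurableJ/mG/cmeasurable_dualpow.
- apply: ae_mono hgood => t H Dt; have [c b] := cv t (H Dt).
  have [c' b'] := cw t (H Dt); split.
    by apply: ccvgM; [exact: ccvg_dualpow|exact: ccvgJ].
  move=> k; rewrite Normc.normcM normc_conj normc_dualpow 1?ltnW // -/q.
  have {2}-> : q = ((q - 1) + 1)%N by rewrite subnK // even_exponent_gt0.
  rewrite exprD expr1 ler_pM ?exprn_ge0 ?normc_ge0 //.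
  by rewrite lerXn2r ?nnegrE ?normc_ge0 // (le_trans ler01).
Qed.

End Controlled.

(** * The energy of a trigonometric polynomial *)

Section Energy.
Context {R : realType}.
Local Notation D := (@circle R).
Notation tpoly := (seq (int * R[i])).
Local Arguments conjc : simpl never.
Local Arguments cis : simpl never.
Variables (j : nat) (a : int -> R).
Hypothesis (hj : (1 < j)%N).
Let q := (2 * j)%N.

Definition weight (s : tpoly) : R := \sum_(x <- s) a x.1 * Re x.2.
Definition energy (s : tpoly) : R :=
  avg (fun t => normc (trig s t) ^+ q) / q%:R - weight s.
(** The value c = 1/2 serves midpoints, c = -1 serves differences, and c in [0, 1] the
    variations, which stay in the cone of nonnegative coefficients. *)
Definition tscale (P : pred int) (c : R) (s : tpoly) : tpoly :=
  [seq (x.1, (if P x.1 then c%:C else 1) * x.2) | x <- s].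

Lemma integrable_pow_trig (s : tpoly) n :
  circle_integrable (fun t => normc (trig s t) ^+ n).
Proof.
apply: (@integrable_dom _ _ (cst ((\sum_(x <- s) normc x.2) ^+ n))).
- exact: measurable_funX (measurable_normc (cmeasurable_trig s)).
- move=> t _; rewrite ger0_norm ?exprn_ge0 ?normc_ge0 //.
  have h := normc_trig_le s t.
  by rewrite lerXn2r ?nnegrE ?normc_ge0 // (le_trans _ h) ?normc_ge0.
- exact: circle_integrable_cst.
Qed.

Lemma weight_cat s1 s2 : weight (s1 ++ s2) = weight s1 + weight s2.
Proof. by rewrite /weight big_cat. Qed.

Lemma tnonneg_scale P c s : 0 <= c -> tnonneg s -> tnonneg (tscale P c s).
Proof.
move=> c0 /allP h; apply/allP => _ /mapP[x /h x0 ->] /=.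
by case: ifP => _; rewrite mulr_ge0 ?ler01 ?ler0c.
Qed.

Lemma weight_scale P c s :
  weight (tscale P c s) = weight s + (c - 1) * weight [seq x <- s | P x.1].
Proof.
rewrite /weight big_map big_filter mulr_sumr [X in _ + X]big_mkcond -big_split.
apply: eq_bigr => x _ /=; case: ifP => _; last by rewrite mul1r addr0.
by rewrite re_mul /= mul0r subr0; ring.
Qed.

Lemma trig_scale P c s t :
  trig (tscale P c s) t = trig s t + (c - 1)%:C * trig [seq x <- s | P x.1] t.
Proof.
rewrite /trig big_map big_filter mulr_sumr [X in _ + X]big_mkcond -big_split.
apply: eq_bigr => x _ /=; case: ifP => _; last by rewrite mul1r addr0.
by rewrite rmorphB; ring.
Qed.

(** Clarkson's inequality integrated; the linear term takes the mean of its values. *)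
Lemma energy_midpoint (s1 s2 : tpoly) :
  energy (tscale predT 2^-1 (s1 ++ s2)) +
  avg (fun t => normc ((1/2)%:C * (trig s1 t - trig s2 t)) ^+ q) / q%:R <=
  (energy s1 + energy s2) / 2.
Proof.
rewrite /energy weight_scale filter_predT weight_cat.
have -> (x y z u : R) : x / q%:R - (y + z + (2^-1 - 1) * (y + z)) + u / q%:R
     = (x + u) / q%:R - (y + z) / 2 by field; rewrite pnatr_eq0 -lt0n even_exponent_gt0.
rewrite (_ : (_ - weight s1 + (_ - weight s2)) / 2 =
  (avg (fun t => normc (trig s1 t) ^+ q) + avg (fun t => normc (trig s2 t) ^+ q)) / 2 / q%:R
  - (weight s1 + weight s2) / 2); last by field; rewrite pnatr_eq0 -lt0n even_exponent_gt0.
rewrite lerD2r ler_pM2r ?invr_gt0 ?even_exponentR_gt0 //.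
have i1 := integrable_pow_trig s1 q; have i2 := integrable_pow_trig s2 q.
have i3 := integrable_pow_trig (tscale predT 2^-1 (s1 ++ s2)) q.
have i4 : circle_integrable (fun t => normc ((1/2)%:C * (trig s1 t - trig s2 t)) ^+ q).
  apply: integrable_ext (integrable_pow_trig
    (tscale predT 2^-1 (s1 ++ tscale predT (-1) s2)) q) => t _.
  congr (normc _ ^+ _); rewrite trig_scale filter_predT trig_cat trig_scale filter_predT.
  rewrite !rmorphB rmorphN rmorph1 div1r; ring.
rewrite [leRHS]mulrC -avgD // -avgD // -avgZ; last exact: circle_integrableD.
apply: avg_le; [exact: circle_integrableD | exact/circle_integrableZ/circle_integrableD |].
move=> t _; rewrite [leRHS]mulrC; apply: le_trans (clarkson _ _ (ltnW hj)).
rewrite lerD2r le_eqVlt; apply/orP; left; apply/eqP; congr (normc _ ^+ _).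
by rewrite trig_scale filter_predT trig_cat !rmorphB rmorph1 div1r; ring.
Qed.

(** Young's inequality between the gradient dualpow v and the polynomial s bounds
    the increment of ||.||_q^q / q from s to v by its derivative at v in the direction
    tau * e.  Since s minimizes up to eps, the derivative of the energy at v can
    lower it by at most eps. *)
Lemma energy_variation (p : R) (s v e : tpoly) (tau eps m : R) :
  p = (2 * j)%:R / (2 * j - 1)%:R ->
  (forall t, trig v t = trig s t + tau%:C * trig e t) ->
  weight v = weight s + tau * weight e ->
  m <= energy v -> energy s <= m + eps ->
  - eps <= tau * (Re (cavg (fun t => dualpow j (trig v t) * conjc (trig e t))) - weight e).
Proof.
move=> hp tv wv mv sm.
have iv := integrable_pow_trig v q; have is_ := integrable_pow_trig s q.
have ip : cintegrable (fun t => dualpow j (trig v t) * conjc (trig e t)).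
  have [ir ii] := cintegrable_trig (tmul (tdual j v) (tconj e)).
  by split; [move: ir | move: ii]; apply: integrable_ext => t _ /=;
    rewrite trig_mul trig_dual trig_conj.
have H : avg (fun t => normc (trig v t) ^+ q) / q%:R -
   avg (fun t => normc (trig s t) ^+ q) / q%:R <=
   tau * Re (cavg (fun t => dualpow j (trig v t) * conjc (trig e t))).
  rewrite -mulrBl mulrC -avgB // -avgZ; last first.
    by apply: integrable_ext (circle_integrableD iv (circle_integrableZ (-1) is_)) => t _; rewrite mulN1r.
  rewrite Re_cavg -avgZ; last exact: ip.1.
  apply: avg_le.
  - apply/circle_integrableZ; apply: integrable_ext (circle_integrableD iv (circle_integrableZ (-1) is_)) => t _.
    by rewrite mulN1r.
  - exact: circle_integrableZ ip.1.
  move=> t _.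
  have [+ _] := young_dual hj hp (dualpow j (trig v t)) (trig s t).
  rewrite dualpow_powR // -/q.
  have -> : trig s t = trig v t - tau%:C * trig e t by rewrite tv addrK.
  rewrite rmorphB rmorphM /= conjc_real mulrBr dualpow_conj ?(ltnW hj) //.
  rewrite [_ * (tau%:C * _)]mulrCA re_add re_opp re_mul [Re tau%:C]/= [Im tau%:C]/= mul0r subr0.
  rewrite [Re (_)%:C]/= -/q => h; rewrite mulrC mulrBl; lra.
move: mv sm H; rewrite /energy wv; lra.
Qed.

End Energy.

Lemma near_minimizers {R : realType} {T : Type} (P : T -> Prop) (E : T -> R)
    (b : R) (eps : nat -> R) :
  (exists x, P x) -> (forall x, P x -> b <= E x) -> (forall k, 0 < eps k) ->
  exists m (x : nat -> T), [/\ forall k, P (x k), forall y, P y -> m <= E y &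
    forall k, E (x k) <= m + eps k].
Proof.
move=> [x0 Px0] lb e0; pose S := [set E x | x in [set x | P x]].
have hl : has_lbound S by exists b => _ [x Px <-]; exact: lb.
have hi : has_inf S by split=> //; exists (E x0); exists x0.
have /choice [x Hx] : forall k, exists x, P x /\ E x <= inf S + eps k.
  by move=> k; have [_ [x Px <-] /ltW h] := inf_adherent (e0 k) hi; exists x.
exists (inf S), x; split=> [k|y Py|k].
- by have [] := Hx k.
- by apply: ge_inf => //; exists y.
- by have [] := Hx k.
Qed.

(** * The extremal function *)

Section Extremal.
Context {R : realType}.
Local Notation mu := (@lebesgue_measure R).
Local Notation D := (@circle R).
Notation tpoly := (seq (int * R[i])).
Local Arguments conjc : simpl never.
Local Arguments cis : simpl never.

(** The value 1 at 0 keeps the modulus equal to 1 everywhere. *)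
Definition phase (z : R[i]) : R[i] := if z == 0 then 1 else z / (normc z)%:C.

Lemma normc_phase z : normc (phase z) = 1.
Proof.
rewrite /phase; case: eqVneq => [_|z0]; first exact: Normc.normc1.
have nz : normc z != 0 by apply: contra_neq z0; exact: Normc.eq0_normc.
by rewrite Normc.normcM Normc.normcV normc_real ger0_norm ?normc_ge0 // divff.
Qed.

Lemma conj_phase_mul z : conjc (phase z) * z = (normc z)%:C.
Proof.
rewrite /phase; case: eqVneq => [->|z0]; first by rewrite mulr0 Normc.normc0.
have nz : (normc z)%:C != 0 :> R[i].
  by apply: contra_neq z0 => /complexI; exact: Normc.eq0_normc.
rewrite rmorphM /= conjc_inv conjc_real mulrAC [_ * z]mulrC mul_conj expr2 rmorphM /=.
by rewrite mulfK.
Qed.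

Variables (j : nat) (p : R) (f : R -> R[i]).
Hypotheses (hj : (1 < j)%N) (hp : p = (2 * j)%:R / (2 * j - 1)%:R)
  (mf : cmeasurable f) (f_int : circle_integrable (fun t => normc (f t) `^ p)).
Let q := (2 * j)%N.
Let a n := normc (fourier_coef f n).

Lemma tnonneg_real (s : tpoly) x : tnonneg s -> x \in s ->
  [/\ conjc x.2 = x.2, Im x.2 = 0 & 0 <= Re x.2].
Proof.
move=> /allP h /h; rewrite lecE => /andP[/eqP i0 r0]; split=> //.
by apply: complex_eq; rewrite ?re_conj ?im_conj // i0 oppr0.
Qed.

(** Turning the coefficients of s by the phases of those of f makes every term of the
    pairing with f equal to its modulus, and leaves the moduli of the coefficients
    unchanged; [trig_majorant] returns from the turned polynomial to s. *)
Lemma weight_le_young (s : tpoly) : tnonneg s ->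
  weight a s <= avg (fun t => normc (trig s t) ^+ q) / q%:R +
                (1 - q%:R^-1) * avg (fun t => normc (f t) `^ p).
Proof.
move=> sP; pose s' := [seq (x.1, phase (fourier_coef f x.1) * x.2) | x <- s].
have s's : tabs s' = s.
  rewrite /tabs /s' -map_comp -[RHS]map_id; apply/eq_in_map => -[n c] xs /=.
  congr (_, _); rewrite normrM !normr_normc normc_phase mul1r -normr_normc ger0_norm //.
  by move/allP: sP => /(_ _ xs).
have -> : weight a s = Re (cavg (fun t => f t * conjc (trig s' t))).
  rewrite (cavg_pair s' (cintegrable_Lp hj hp mf f_int)) big_map /weight.
  rewrite big_seq [in RHS]big_seq.
  elim/big_ind2 : _ => //= [x1 x2 y1 y2 -> ->|x xs]; first by rewrite re_add.
  have [cx i0 _] := tnonneg_real sP xs.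
  rewrite rmorphM /= mulrAC conj_phase_mul cx re_mul i0 mulr0 subr0.
  by [].
apply: le_trans (avg_pair_le hj hp mf (cmeasurable_trig s') f_int (integrable_pow_trig s' q)) _.
rewrite lerD2r ler_pM2r ?invr_gt0 ?(even_exponentR_gt0 hj) // -[in leRHS]s's.
exact: trig_majorant (ltnW hj).
Qed.

Lemma weight_le_majorant (h : R -> R[i]) (s : tpoly) :
  cintegrable h -> majorant f h -> tnonneg s ->
  weight a s <= Re (cavg (fun t => h t * conjc (trig s t))).
Proof.
move=> ih fh sP; rewrite cavg_pair // /weight big_seq [in leRHS]big_seq.
elim/big_ind2 : _ => //= [x1 x2 y1 y2 h1 h2|x xs]; first by rewrite re_add lerD.
have [cx i0 r0] := tnonneg_real sP xs.
rewrite cx re_mul i0 mul0r subr0 mulrC ler_wpM2l //.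
by have := fh x.1; rewrite normr_normc lecE => /andP[].
Qed.

Lemma ler_cvg (u v : nat -> R) (l l' : R) :
  u k @[k --> \oo] --> l -> v k @[k --> \oo] --> l' -> (forall k, u k <= v k) -> l <= l'.
Proof.
move=> ul vl uv.
rewrite -(cvg_lim _ ul) // -(cvg_lim _ vl) //; apply: ler_lim.
- by apply/cvg_ex; exists l.
- by apply/cvg_ex; exists l'.
- exact: nearW.
Qed.

Lemma fourier_pair1 (h : R -> R[i]) n c : cintegrable h ->
  cavg (fun t => h t * conjc (trig [:: (n, c)] t)) = conjc c * fourier_coef h n.
Proof. by move=> ih; rewrite cavg_pair // big_seq1. Qed.

(** Here eps k = tau k * del k, where eps k measures how close the k-th polynomial is
    to minimal and tau k is the size of the variations applied to it.  Both tau and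
    eps / tau tend to 0, so that the variations disappear in the limit while the
    inequalities from [energy_variation], divided by tau, become exact.  The exponent
    of eps also makes the sequence fast enough for [fast_limit]. *)
Lemma extremal_function : exists G : R -> R[i],
  let F t := dualpow j (G t) in
  let A := avg (fun t => normc (G t) ^+ q) in
  [/\ cmeasurable G /\ circle_integrable (fun t => normc (G t) ^+ q),
      (forall n, 0 <= fourier_coef G n) /\ majorant f F,
      forall n, Re (fourier_coef G n) * (Re (fourier_coef F n) - a n) <= 0 /\
        fourier_coef G n ^+ (2 * j - 1) <= fourier_coef F n,
      forall H : R -> R[i], cmeasurable H ->
        circle_integrable (fun t => normc (H t) `^ p) -> majorant f H ->
        A <= Re (cavg (fun t => H t * conjc (G t)))
    & A <= avg (fun t => normc (f t) `^ p)].
Proof.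
have j0 : (0 < j)%N := ltnW hj.
have q_gt0 : (0 < q)%N := even_exponent_gt0 hj.
have qR : 0 < q%:R :> R := even_exponentR_gt0 hj.
pose tau k : R := 2^-1 ^+ k.
pose del k : R := 2^-1 ^+ (k * q).
pose eps k : R := 2^-1 ^+ (k * q.+1).
have epsE k : eps k = tau k * del k by rewrite /eps mulnS exprD.
have tau_gt0 k : 0 < tau k by rewrite exprn_gt0 // invr_gt0.
have eps_gt0 k : 0 < eps k by rewrite exprn_gt0 // invr_gt0.
have half0 : (0 : R) <= 2^-1 by rewrite invr_ge0.
have half1 : (2^-1 : R) <= 1 by rewrite invf_le1 // ler1n.
have tau_le1 k : tau k <= 1 by rewrite exprn_ile1.
have tau0 : tau k @[k --> \oo] --> (0 : R).
  by apply: cvg_expr; rewrite ger0_norm ?invr_ge0 // invf_lt1 // ltr1n.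
have del0 : del k @[k --> \oo] --> (0 : R).
  rewrite /del; under eq_fun do rewrite mulnC exprM.
  apply: cvg_expr; rewrite ger0_norm ?exprn_ge0 ?invr_ge0 //.
  by rewrite exprn_ilt1 -?lt0n // ?invr_ge0 // invf_lt1 // ltr1n.
have lb s : tnonneg s -> - ((1 - q%:R^-1) * avg (fun t => normc (f t) `^ p)) <= energy j a s.
  by move=> /weight_le_young; rewrite /energy -/q; lra.
have [m [x [xP mle xle]]] := near_minimizers
  (ex_intro (fun s : tpoly => tnonneg s) [::] isT) lb eps_gt0.
pose g k := trig (x k).
have id_ k : circle_integrable (fun t => normc (g k t - g k.+1 t) ^+ q).
  apply: integrable_ext (integrable_pow_trig
    (x k ++ tscale predT (-1) (x k.+1)) q) => t _.
  congr (normc _ ^+ _); rewrite trig_cat trig_scale filter_predT /g.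
  by rewrite !rmorphB rmorphN rmorph1; ring.
have dle k : avg (fun t => normc (g k t - g k.+1 t) ^+ q) <= (2 ^+ q * q%:R) * 2^-1 ^+ (k * q.+1).
  have midP : tnonneg (tscale predT 2^-1 (x k ++ x k.+1)).
    by rewrite tnonneg_scale ?invr_ge0 // tnonneg_cat !xP.
  have := energy_midpoint a hj (x k) (x k.+1); rewrite -/q.
  rewrite (@avg_ext _ _ (fun t => 2^-1 ^+ q * normc (g k t - g k.+1 t) ^+ q)); last first.
    by move=> t _; rewrite Normc.normcM normc_real ger0_norm ?divr_ge0 // div1r exprMn.
  rewrite avgZ //; set X := avg _ => mid.
  have e1 : eps k.+1 <= eps k by apply: ler_wiXn2l => //; rewrite leq_mul2r leqnSn orbT.
  have : 2^-1 ^+ q * X / q%:R <= eps k.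
    by move: mid (mle _ midP) (xle k) (xle k.+1) e1; lra.
  rewrite ler_pdivrMr // exprVn ler_pdivrMl ?exprn_gt0 // => /le_trans; apply.
  by rewrite -/(eps k) [eps k * _]mulrC mulrA.
have [G [M [mG M1 iM good]]] : exists G M, [/\ cmeasurable G, forall t, 1 <= M t,
    circle_integrable (fun t => M t ^+ q) &
    {ae mu, forall t, D t -> ccvg (g ^~ t) (G t) /\ forall k, normc (g k t) <= M t}].
  apply: (@fast_limit _ _ _ (2 ^+ q * q%:R) (1 + \sum_(y <- x 0%N) normc y.2)) => //.
  - by rewrite lerDl sumr_ge0 // => y _; exact: normc_ge0.
  - by move=> k; exact: cmeasurable_trig.
  - by move=> t; rewrite (le_trans (normc_trig_le _ _)) // lerDr.
have M0 t : 0 <= M t := le_trans ler01 (M1 t).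
have leK2 : (1 : R) <= 2 by rewrite ler1n.
have tg : controlled g G M 1 g.
  by split=> [k|t [c b]]; [exact: cmeasurable_trig|split => // k; rewrite mul1r].
have [iG cA] := controlled_avg_pow mG M1 (lexx 1) iM good tg.
have cG n := controlled_fourier hj mG M1 (lexx 1) iM good n tg.
have cF n := controlled_fourier_dual hj mG M1 (lexx 1) iM good n tg.
have gE k n : fourier_coef (g k) n = tcoef (x k) n by exact: fourier_trig.
have dualE s : (fun t : R => dualpow j (trig s t)) = trig (tdual j s).
  by apply/funext => t; rewrite trig_dual.
have FE k n : fourier_coef (fun t => dualpow j (g k t)) n = tcoef (tdual j (x k)) n.
  by rewrite dualE fourier_trig.
have G0 n : 0 <= fourier_coef G n.
  by apply: ccvg_ge0 (cG n) => k; rewrite gE tcoef_ge0.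
have F0 n : 0 <= fourier_coef (fun t => dualpow j (G t)) n.
  by apply: ccvg_ge0 (cF n) => k; rewrite FE tcoef_ge0 // tnonneg_dual.
have GF n : fourier_coef G n ^+ (2 * j - 1) <= fourier_coef (fun t => dualpow j (G t)) n.
  rewrite -subr_ge0 -mulN1r.
  apply: ccvg_ge0 (ccvgD (cF n) (ccvgM (ccvg_cst _) (ccvgX _ (cG n)))) => k.
  by rewrite mulN1r subr_ge0 gE FE tcoef_dual_ge.
(* Adding tau k times the n-th character gives a n <= Fhat n + del k. *)
have aF n : a n <= Re (fourier_coef (fun t => dualpow j (G t)) n).
  pose v k := x k ++ [:: (n, (tau k)%:C)].
  have tv : controlled g G M 2 (fun k => trig (v k)).
    split=> [k|t [c b]]; first exact: cmeasurable_trig; split.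
      rewrite -[G t]addr0 -[X in ccvg _ (_ + X)](mul0r (cis (n%:~R * t))).
      under [X in ccvg X]eq_fun do rewrite trig_cat trig1.
      apply: ccvgD => //; apply: ccvgM; last exact: ccvg_cst.
      exact: ccvg_real.
    move=> k; rewrite trig_cat trig1 (le_trans (normc_triangle _ _)) // mulr2n mulrDl mul1r.
    apply: lerD; first exact: b.
    rewrite Normc.normcM normc_cis mulr1 normc_real ger0_norm; last exact: ltW.
    exact: le_trans (tau_le1 k) (M1 t).
  have [cv _] := controlled_fourier_dual hj mG M1 leK2 iM good n tv.
  have -> : Re (fourier_coef (fun t => dualpow j (G t)) n) =
     Re (fourier_coef (fun t => dualpow j (G t)) n) + 0 by rewrite addr0.
  apply: ler_cvg (cvg_cst (a n)) (cvgD cv del0) _ => k /=.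
  have vP : tnonneg (v k) by rewrite tnonneg_cat xP /= ler0c ltW.
  have trv t : trig (v k) t = trig (x k) t + (tau k)%:C * trig [:: (n, 1)] t.
    by rewrite trig_cat !trig1 mul1r.
  have wv : weight a (v k) = weight a (x k) + tau k * weight a [:: (n, 1)].
    by rewrite weight_cat /weight !big_seq1 /= mulr1 [a n * _]mulrC.
  have := energy_variation hj hp trv wv (mle _ vP) (xle k).
  rewrite fourier_pair1 ?conjc1 ?mul1r; last by rewrite dualE; exact: cintegrable_trig.
  by rewrite /weight !big_seq1 /= mulr1 epsE -mulrN ler_pM2l //; lra.
(* Shrinking the n-th coefficient stays in the cone even where it is 0, so no case
   distinction on Ghat n is needed. *)
have comp n : Re (fourier_coef G n) *
    (Re (fourier_coef (fun t => dualpow j (G t)) n) - a n) <= 0.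
  pose c k := tcoef (x k) n.
  have cc : ccvg c (fourier_coef G n).
    by have := cG n; under [X in ccvg X]eq_fun do rewrite gE.
  have c0 k : 0 <= c k by exact: tcoef_ge0.
  have cR k : [/\ conjc (c k) = c k, Im (c k) = 0 & 0 <= Re (c k)].
    have := @tnonneg_real [:: (n, c k)] (n, c k); apply; last by rewrite inE.
    by rewrite /= c0.
  have [C C0 cC] : exists2 C, 0 <= C & forall k, normc (c k) <= C.
    have /cvg_seq_bounded [B [_ HB]] : cvgn (fun k => Re (c k)).
      by apply/cvg_ex; exists (Re (fourier_coef G n)); exact: cc.1.
    exists (`|B| + 1); first by rewrite addr_ge0.
    have B1 : B < `|B| + 1 by rewrite (le_lt_trans (ler_norm B)) // ltrDl.
    move=> k; have := HB _ B1 k I; apply: le_trans.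
    by have [_ i0 _] := cR k; rewrite normc_sqrt i0 expr0n addr0 sqrtr_sqr.
  pose v k := tscale (pred1 n) (1 - tau k) (x k).
  pose e k : tpoly := [:: (n, c k)].
  have trv k t : trig (v k) t = trig (x k) t + (- tau k)%:C * trig (e k) t.
    rewrite trig_scale addrAC subrr sub0r; congr (_ + _ * _).
    rewrite trig1 /trig big_filter /c /tcoef mulr_suml.
    by apply: eq_bigr => y /eqP ->.
  have wv k : weight a (v k) = weight a (x k) + (- tau k) * weight a (e k).
    rewrite weight_scale addrAC subrr sub0r; congr (_ + _ * _).
    rewrite /weight big_seq1 big_filter /c /tcoef /= (big_morph _ re_add (erefl _)) mulr_sumr.
    by apply: eq_bigr => y /eqP ->.
  have K1 : 1 <= 1 + C by rewrite lerDl.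
  have tv : controlled g G M (1 + C) (fun k => trig (v k)).
    split=> [k|t [gc b]]; first exact: cmeasurable_trig; split.
      rewrite -[G t]addr0 -[X in ccvg _ (_ + X)](mul0r (fourier_coef G n * cis (n%:~R * t))).
      under [X in ccvg X]eq_fun do rewrite trv trig1.
      apply: ccvgD => //; apply: ccvgM; last by apply: ccvgM => //; exact: ccvg_cst.
      by apply: ccvg_real; rewrite -oppr0; exact: cvgN.
    move=> k; rewrite trv trig1 (le_trans (normc_triangle _ _)) // mulrDl mul1r.
    apply: lerD; first exact: b.
    rewrite !Normc.normcM normc_cis mulr1 normc_real normrN ger0_norm; last exact: ltW.
    apply: (@le_trans _ _ (1 * C)); first by rewrite ler_pM ?normc_ge0 // ltW.
    by rewrite mulrC ler_wpM2l.
  have [cv _] := controlled_fourier_dual hj mG M1 K1 iM good n tv.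
  apply: ler_cvg (cvgM cc.1 (cvgB cv (cvg_cst (a n)))) del0 _ => k.
  have tau1 : 0 <= 1 - tau k by rewrite subr_ge0.
  have := energy_variation hj hp (trv k) (wv k) (mle _ (tnonneg_scale _ tau1 (xP k))) (xle k).
  have [cck ck0 _] := cR k.
  have -> : weight a (e k) = a n * Re (c k) by rewrite /weight big_seq1.
  rewrite fourier_pair1; last by rewrite dualE; exact: cintegrable_trig.
  rewrite cck re_mul ck0 mul0r subr0 epsE mulNr lerN2.
  by rewrite ler_pM2l // [a n * _]mulrC -mulrBr.
(* Shrinking the whole polynomial bounds ||G||_q^q by the limit of the linear terms. *)
have [w wA wle] : exists2 w : nat -> R, w k @[k --> \oo] --> avg (fun t => normc (G t) ^+ q) &
   forall k, w k <= weight a (x k).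
  pose v k := tscale predT (1 - tau k) (x k).
  have trv k t : trig (v k) t = trig (x k) t + (- tau k)%:C * trig (x k) t.
    by rewrite trig_scale filter_predT addrAC subrr sub0r.
  have wv k : weight a (v k) = weight a (x k) + (- tau k) * weight a (x k).
    by rewrite weight_scale filter_predT addrAC subrr sub0r.
  have tv : controlled g G M 1 (fun k => trig (v k)).
    split=> [k|t [gc b]]; first exact: cmeasurable_trig; split.
      rewrite -[G t]addr0 -[X in ccvg _ (_ + X)](mul0r (G t)).
      under [X in ccvg X]eq_fun do rewrite trv.
      apply: ccvgD => //; apply: ccvgM => //.
      by apply: ccvg_real; rewrite -oppr0; exact: cvgN.
    move=> k; have -> : trig (v k) t = (1 - tau k)%:C * trig (x k) t.
      by rewrite trv rmorphB rmorph1 rmorphN; ring.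
    rewrite mul1r Normc.normcM normc_real ger0_norm; last by rewrite subr_ge0.
    by rewrite -[leRHS]mul1r ler_pM ?subr_ge0 ?normc_ge0 ?b // gerBl ltW.
  have [cv _] := controlled_dual_pair hj mG M1 (lexx 1) iM good tv tg.
  exists (fun k => Re (cavg (fun t => dualpow j (trig (v k) t) * conjc (g k t))) - del k).
    by rewrite -[X in _ --> X]subr0; exact: cvgB.
  move=> k; have tau1 : 0 <= 1 - tau k by rewrite subr_ge0.
  have := energy_variation hj hp (trv k) (wv k) (mle _ (tnonneg_scale _ tau1 (xP k))) (xle k).
  by rewrite epsE mulNr lerN2 ler_pM2l // lerBlDr addrC -lerBlDr.
exists G; split => //.
- split=> // n; rewrite normr_normc lecE /= aF andbT.
  by have := F0 n; rewrite lecE => /andP[].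
- move=> H mH iH fH.
  have [cv _] := controlled_pair hj hp mG M1 (lexx 1) iM good tg mH iH.
  apply: ler_cvg wA cv _ => k; apply: le_trans (wle k) _.
  by apply: weight_le_majorant => //; exact: (cintegrable_Lp hj hp).
- have h : avg (fun t => normc (G t) ^+ q) <=
      avg (fun t => normc (G t) ^+ q) / q%:R + (1 - q%:R^-1) * avg (fun t => normc (f t) `^ p).
    apply: ler_cvg wA (cvgD (cvgM cA (cvg_cst _)) (cvg_cst _)) _ => k /=.
    exact: le_trans (wle k) (weight_le_young (xP k)).
  exact: (le_of_le_mean hj h).
Qed.

End Extremal.

(** * Minimal majorants *)

Theorem theorem1p1 (R : realType) (j : nat) (p : R) (f : R -> R[i])
    (hj : (1 < j)%N) (hp : p = (2 * j)%:R / (2 * j - 1)%:R)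
    (hf : circle_Lp p f) :
  [/\ exists F : R -> R[i],
        [/\ circle_Lp p F, majorant f F &
            (circle_norm p F <= circle_norm p f)%E],
      exists F : R -> R[i], minimal_majorant p f F
    & forall F : R -> R[i], minimal_majorant p f F ->
      exists G : R -> R[i],
        [/\ circle_Lp (2 * j)%:R G,
            ae_eq lebesgue_measure circle F
              (fun t => conjc (G t) ^+ (j - 1) * G t ^+ j),
            forall n : int, 0 <= fourier_coef G n,
            forall n : int, `|fourier_coef f n| < fourier_coef F n ->
              fourier_coef G n = 0
          & forall n : int, fourier_coef f n = 0 -> fourier_coef G n = 0]].
Proof.
have j0 : (0 < j)%N := ltnW hj.
have [p0 _ _] := conj_exponent hj hp.
have f_int := circle_Lp_integrable p0 hf.
have [G [[mG iG] [G0 fF] compl lower A_le_f]] :=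
  extremal_function hj hp (proj1 hf) f_int.
set F0 := fun t => dualpow j (G t) in fF compl.
set A := avg _ in lower A_le_f.
have mF0 : cmeasurable F0 by exact: cmeasurable_dualpow.
have iF0 : circle_integrable (fun t => normc (F0 t) `^ p).
  by apply: integrable_ext iG => t _; rewrite dualpow_powR.
have F0A : avg (fun t => normc (F0 t) `^ p) = A.
  by apply: avg_ext => t _; rewrite dualpow_powR.
have LF0 : circle_Lp p F0 by exact: circle_LpP.
have A_le H : circle_Lp p H -> majorant f H -> A <= avg (fun t => normc (H t) `^ p).
  move=> LH fH; have iH := circle_Lp_integrable p0 LH.
  apply: (le_of_le_mean hj).
  exact: le_trans (lower H (proj1 LH) iH fH) (avg_pair_le hj hp (proj1 LH) mG iH iG).
have F0min : minimal_majorant p f F0.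
  split=> [||H LH fH]; [exact: LF0|exact: fF|].
  by rewrite (le_circle_norm p0 iF0 (circle_Lp_integrable p0 LH)) F0A; exact: A_le.
split.
- by exists F0; split; rewrite ?(le_circle_norm p0 iF0 f_int) ?F0A.
- by exists F0.
move=> F [LF fF' Fmin]; have iF := circle_Lp_integrable p0 LF.
have FA : avg (fun t => normc (F t) `^ p) = A.
  apply/le_anti; rewrite (A_le F LF fF') andbT -F0A.
  by rewrite -(le_circle_norm p0 iF iF0); exact: Fmin.
have FF0 : ae_eq lebesgue_measure circle F F0.
  apply: (avg_pair_eq hj hp (proj1 LF) mG iF iG); apply/le_anti/andP; split.
    exact: (avg_pair_le hj hp (proj1 LF) mG iF iG).
  by rewrite FA; apply: le_trans (lower F (proj1 LF) iF fF'); rewrite -/A mulrC -mulrDl addrC subrK mul1r.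
have FFE n : fourier_coef F n = fourier_coef F0 n.
  have mc : cmeasurable (fun t : R => cis (- (n%:~R * t))).
    by under [X in cmeasurable X]eq_fun do rewrite -mulNr; exact: cmeasurable_cis.
  rewrite !fourier_coefE; apply: ae_eq_cavg.
  - exact: cmeasurableM (proj1 LF) mc.
  - exact: cmeasurableM.
  - by apply: ae_mono FF0 => t H Dt; rewrite H.
have GR n : fourier_coef G n = (Re (fourier_coef G n))%:C /\ 0 <= Re (fourier_coef G n).
  have := G0 n; rewrite lecE => /andP[/eqP i0 r0]; split=> //.
  exact: complex_eq.
have G_eq0 n : Re (fourier_coef G n) <= 0 -> fourier_coef G n = 0.
  move=> rle; have [-> r0] := GR n; congr (_%:C).
  by apply/le_anti; rewrite rle r0.
exists G; split => //.
- apply: circle_LpP => //.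
  by apply: integrable_ext iG => t _; rewrite powR_mulrn // normc_ge0.
- move=> n; rewrite FFE normr_normc ltcE /= => /andP[_ lt]; apply: G_eq0.
  have [+ _] := compl n; rewrite pmulr_lle0 // subr_gt0.
  exact: lt.
- move=> n fn0; apply: G_eq0; rewrite leNgt; apply/negP => gt0.
  have [+ +] := compl n; rewrite fn0 Normc.normc0 subr0 pmulr_rle0 // => Fle0.
  have [-> _] := GR n; rewrite -rmorphXn lecE => /andP[_] /=.
  by rewrite leNgt (le_lt_trans Fle0) // exprn_gt0.
Qed.
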